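(* For $n\ge 3$ let $W_n$ denote the $n$-gonal pyramid. Then every polyhedron, save the pyramids $W_n$ with $n\neq 4$, can be generated from the square pyramid $W_4$ by a finite (possibly empty) sequence of operations, each of which is either adding an edge or expanding a vertex. Equivalently, every polyhedron, save the pyramids $W_n$ with $n\neq 4$, can be generated from $W_4$ by a finite (possibly empty) sequence of operations, each of which is either adding an edge or taking the dual polyhedron.
   Context: All graphs are finite, undirected, without loops or multiple edges, and are considered up to isomorphism. A polyhedron is a planar, $3$-connected graph. A polyhedron $G$ has a unique embedding in the sphere, so its faces, the cyclic order of neighbours around each vertex, and its plane dual $G^*$ (which is again a polyhedron) are well defined. The $n$-gonal pyramid $W_n$ (wheel graph), $n\ge 3$, consists of a cycle $a_1,\dots,a_n$ together with one further vertex adjacent to all of $a_1,\dots,a_n$. Operations on a polyhedron: (1) Adding an edge: joining two non-adjacent vertices by a new edge in such a way that the resulting graph is again a polyhedron (i.e. the two vertices lie on a common face). (2) Expanding a vertex $x$: write the neighbours of $x$ in cyclic order around $x$ as $a_1,\dots,a_m,b_1,\dots,b_n$ with $m,n\ge 2$; delete the edges $xb_1,\dots,xb_n$ and insert a new vertex $y$ and the new edges $yx,yb_1,\dots,yb_n$. (In particular vertices of degree $3$ cannot be expanded.) (3) Taking the dual: replacing $G$ by $G^*$. *)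

(* Defs.v *)
From mathcomp Require Import all_boot fingroup perm.

Set Implicit Arguments.
Unset Strict Implicit.
Unset Printing Implicit Defensive.

Record sgraph := SGraph {
  vertex :> finType;
  adj : rel vertex;
  adj_sym : symmetric adj;
  adj_irr : irreflexive adj
}.

Definition giso (G H : sgraph) : Prop :=
  exists2 f : G -> H, bijective f & {mono f : u v / adj u v}.

Definition connected_off (G : sgraph) (S : {set G}) : Prop :=
  forall x y : G, x \notin S -> y \notin S ->
  connect [rel u v | [&& adj u v, u \notin S & v \notin S]] x y.

Definition connected (G : sgraph) : Prop := connected_off (set0 : {set G}).

Definition three_connected (G : sgraph) : Prop :=
  3 < #|G| /\ forall S : {set G}, #|S| < 3 -> connected_off S.

(* Embeddings are rotation systems: a permutation of the darts (oriented      *)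
(* edges) whose cycles list, for each vertex, the outgoing darts in cyclic    *)
(* order. Faces are the cycles of (x, y) |-> (y, z), with z following x       *)
(* around y. For a connected graph this describes the cellular embeddings in  *)
(* closed orientable surfaces, and the surface is the sphere exactly when     *)
(* Euler's formula V + F = E + 2 holds.                                       *)

Definition dart (G : sgraph) : finType := {d : G * G | adj d.1 d.2}.

Section Darts.
Variable G : sgraph.

Definition src (d : dart G) : G := (val d).1.
Definition dst (d : dart G) : G := (val d).2.

Fact drev_subproof (d : dart G) : adj (dst d) (src d).
Proof. by rewrite adj_sym; apply: (valP d). Qed.

Definition drev (d : dart G) : dart G :=
  Sub (dst d, src d) (drev_subproof d).

Lemma drevK : involutive drev.
Proof. by move=> d; apply/val_inj; rewrite [RHS]surjective_pairing. Qed.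

Definition drev_perm : {perm dart G} := perm (inv_inj drevK).

Definition rotation_system (s : {perm dart G}) : Prop :=
  forall d, porbit s d = [set d' | src d' == src d].

Definition faces (s : {perm dart G}) : {set {set dart G}} :=
  porbits (drev_perm * s)%g.

Definition sphere_embedding (s : {perm dart G}) : Prop :=
  [/\ connected G, rotation_system s
    & #|G| + #|faces s| = #|dart G|./2 + 2].

End Darts.

Record polyhedron := Polyhedron {
  pgraph :> sgraph;
  polyhedron_3connected : three_connected pgraph;
  polyhedron_planar : exists s : {perm dart pgraph}, sphere_embedding s
}.

Section Wheel.
Variable n : nat.

(* [None] is the apex. The condition [i != j] only matters for n = 1.         *)
Definition wheel_adj (u v : option 'I_n) : bool :=
  match u, v with
  | None, None => false
  | Some i, Some j => (i != j) && ((j == ordS i) || (i == ordS j))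
  | _, _ => true
  end.

Fact wheel_sym : symmetric wheel_adj.
Proof. by case=> [i|] [j|] //=; rewrite eq_sym orbC. Qed.

Fact wheel_irr : irreflexive wheel_adj.
Proof. by case=> [i|] //=; rewrite eqxx. Qed.

Definition wheel : sgraph := SGraph wheel_sym wheel_irr.

End Wheel.

Section AddEdge.
Variables (G : sgraph) (x y : G).

Definition add_edge_adj (u v : G) : bool :=
  adj u v || [&& u != v, u \in [set x; y] & v \in [set x; y]].

Fact add_edge_sym : symmetric add_edge_adj.
Proof.
by move=> u v; rewrite /add_edge_adj adj_sym eq_sym [(u \in _) && _]andbC.
Qed.

Fact add_edge_irr : irreflexive add_edge_adj.
Proof. by move=> u; rewrite /add_edge_adj adj_irr eqxx. Qed.

Definition add_edge : sgraph := SGraph add_edge_sym add_edge_irr.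

End AddEdge.

Section Expand.
Variables (G : sgraph) (x : G) (b : seq G).

(* [None] is the new vertex y, which takes over the neighbours [b] of x.      *)
Definition expand_adj (u v : option G) : bool :=
  match u, v with
  | None, None => false
  | None, Some w | Some w, None => (w == x) || (w \in b)
  | Some u, Some v =>
      [&& adj u v, ~~ ((u == x) && (v \in b)) & ~~ ((v == x) && (u \in b))]
  end.

Fact expand_sym : symmetric expand_adj.
Proof. by case=> [u|] [v|] //=; rewrite adj_sym [X in _ && X]andbC. Qed.

Fact expand_irr : irreflexive expand_adj.
Proof. by case=> [u|] //=; rewrite adj_irr. Qed.

Definition expand : sgraph := SGraph expand_sym expand_irr.

End Expand.

Section Dual.
Variables (G : sgraph) (s : {perm dart G}).

(* Two faces are adjacent when they share an edge. In a polyhedron no edge    *)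
(* has the same face on both sides and two faces share at most one edge, so   *)
(* this simple graph is the plane dual.                                       *)
Definition dual_adj (f g : {f : {set dart G} | f \in faces s}) : bool :=
  (f != g) && [exists d in val f, drev d \in val g].

Fact dual_sym : symmetric dual_adj.
Proof.
move=> f g; rewrite /dual_adj eq_sym; congr (_ && _).
by apply/exists_inP/exists_inP => -[d df dg]; exists (drev d); rewrite ?drevK.
Qed.

Fact dual_irr : irreflexive dual_adj.
Proof. by move=> f; rewrite /dual_adj eqxx. Qed.

Definition dual : sgraph := SGraph dual_sym dual_irr.

End Dual.

(* The operations, as relations between polyhedra up to isomorphism. The      *)
(* embedding of a polyhedron is unique up to orientation reversal, which      *)
(* affects neither expansions nor the dual, so it is quantified               *)
(* existentially.                                                             *)

Definition edge_addition (G H : polyhedron) : Prop :=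
  exists x y : G, [/\ x != y, ~~ adj x y & giso (add_edge x y) H].

Definition vertex_expansion (G H : polyhedron) : Prop :=
  exists s : {perm dart G}, sphere_embedding s /\
  exists (d : dart G) (a b : seq G),
    [/\ [seq dst d' | d' <- fingraph.orbit s d] = a ++ b,
        2 <= size a, 2 <= size b & giso (expand (src d) b) H].

Definition duality (G H : polyhedron) : Prop :=
  exists2 s : {perm dart G}, sphere_embedding s & giso (dual s) H.

Inductive generated (op : polyhedron -> polyhedron -> Prop) (G0 : sgraph) :
    polyhedron -> Prop :=
  | generated_start (G : polyhedron) : giso G0 G -> generated op G0 G
  | generated_step (G H : polyhedron) :
      generated op G0 G -> op G H -> generated op G0 H.

(* Main.v *)
From mathcomp Require Import all_boot fingroup perm.
From mathcomp Require Import zify.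
Require Import Defs.
(* A polyhedron is encoded as a combinatorial map: an edge involution e and a
   rotation n on the darts, with face permutation e * n, so that the dual map is
   (e, e * n). By Euler's inequality, splitting vertices of a spherical map
   disconnects it; hence 3-connectivity of the graph is equivalent to a
   self-dual local condition on the map, and the dual of a polyhedron is a
   polyhedron.

   If neither G nor its dual has an edge whose deletion leaves a polyhedron,
   every triangle has two trivalent vertices and every trivalent vertex lies on
   two triangles (triangle_deletion); by Euler's formula one of the two occurs,
   and turning around a vertex shows that G is a pyramid. Otherwise G arises
   from a smaller polyhedron by adding an edge, or its dual does, in which case
   G arises from the dual of that polyhedron by a vertex expansion. The smaller
   polyhedron can be chosen not to be an excluded pyramid: when deleting pq
   leaves one, delete the spoke at p instead. *)

Set Implicit Arguments.
Unset Strict Implicit.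
Unset Printing Implicit Defensive.

(** * Orbits of permutations and Euler's inequality *)

(** Planarity enters only through orbit counts: [euler_inequality] holds for arbitrary permutations,
    and V + F > E + 2 forces the map to be disconnected. Cutting a vertex open between two corners
    multiplies [n], and hence also [e * n], by the same transposition, so vertices and faces are
    counted by the same lemmas.

    A map and its dual live on the same darts. Contraction can therefore be defined as deletion in
    the dual, and the number of darts serves as induction measure on both sides.

    An excluded pyramid among the smaller polyhedra would block the induction. What is carried along
    is the stronger condition [~~ wheel_like]: it is decidable from degrees and invariant under
    duality, so a deletion chosen well in the dual is also good for the contraction that it
    induces. *)

Section Orbits.
Variable D : finType.
Implicit Types (s t : {perm D}) (x y z : D).

Lemma porbit_step s x : porbit s (s x) = porbit s x.
Proof. exact: (porbit_perm s 1). Qed.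

Lemma porbit_stepV s x : porbit s (s^-1%g x) = porbit s x.
Proof. by rewrite -[in RHS](permKV s x) porbit_step. Qed.

Lemma eq_porbit_in s x y : porbit s x = porbit s y <-> x \in porbit s y.
Proof. by rewrite -eq_porbit_mem; split=> [->|/eqP]. Qed.

Lemma porbit_closed s (A : {pred D}) x :
  (forall z, z \in A -> s z \in A) -> x \in A -> {subset porbit s x <= A}.
Proof.
move=> sA xA _ /porbitP[i ->]; elim: i => [|i IHi]; first by rewrite perm1.
by rewrite expgSr permM sA.
Qed.

Lemma porbit_invariant (T : eqType) (g : D -> T) s x y :
  (forall z, g (s z) = g z) -> porbit s x = porbit s y -> g x = g y.
Proof.
move=> gs /eq_porbit_in xy; apply/eqP.
by apply: (porbit_closed (A := [pred z | g z == g y])) xy => [z|];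
  rewrite !inE ?gs.
Qed.

Lemma porbit_agree s t z :
  {in porbit s z, s =1 t} -> porbit t z = porbit s z.
Proof.
move=> st; have H i : (t ^+ i)%g z = (s ^+ i)%g z.
  elim: i => [|i IHi]; first by rewrite !perm1.
  by rewrite !expgSr !permM IHi st // mem_porbit.
by apply/porbit_setP=> y; apply/porbitP/porbitP=> -[i ->]; exists i; rewrite H.
Qed.

Lemma porbits_tperm_split s x y : x != y -> porbit s x = porbit s y ->
  #|porbits (s * tperm x y)%g| = #|porbits s|.+1.
Proof.
(* [porbits_mul_tperm] has the transposition on the other side; inversion reverses the product and
   keeps the orbits. *)
move=> xy /eqP sxy; have := porbits_mul_tperm s^-1%g x y.
rewrite /= -(porbitsV (_ * _)) invMg tpermV invgK porbitsV !porbitV xy.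
by rewrite -eq_porbit_mem sxy addn0 addn1.
Qed.

Lemma porbits_tperm_merge s x y : porbit s x <> porbit s y ->
  #|porbits (s * tperm x y)%g|.+1 = #|porbits s|.
Proof.
move=> /eqP sxy; have := porbits_mul_tperm s^-1%g x y.
rewrite /= -(porbitsV (_ * _)) invMg tpermV invgK porbitsV !porbitV.
have -> : x != y by apply: contraNneq sxy => ->.
by rewrite -eq_porbit_mem sxy /= addn1 addn2 => -[].
Qed.

Lemma porbits_tperm_bound s x y : x != y ->
  #|porbits (s * tperm x y)%g| <= #|porbits s|.+1.
Proof.
move=> xy; case: (porbit s x =P porbit s y) => [/(porbits_tperm_split xy)->//|].
by move/porbits_tperm_merge => <-; rewrite ltnW.
Qed.

Lemma porbit_tperm_merge s x y : porbit s x <> porbit s y ->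
  porbit (s * tperm x y)%g x = porbit (s * tperm x y)%g y.
Proof.
move=> sxy; apply/eqP/negPn/negP => /eqP txy.
have := porbits_tperm_merge txy.
rewrite -mulgA tperm2 mulg1; have := porbits_tperm_merge sxy; lia.
Qed.

(** The new orbit of [x] contains [y] and is closed under [s], because the transposition only
    exchanges these two points. *)
Lemma porbit_tperm_merge_sub s x y z : porbit s x <> porbit s y ->
  porbit s z = porbit s x \/ porbit s z = porbit s y ->
  porbit (s * tperm x y)%g z = porbit (s * tperm x y)%g x.
Proof.
move=> sxy; pose t := (s * tperm x y)%g.
suff H : {subset porbit s x <= porbit t x} /\ {subset porbit s y <= porbit t x}.
  case: H => Hx Hy.
  by case=> /eq_porbit_in z_; apply/eq_porbit_in; [apply: Hx | apply: Hy].
have cl w : w \in porbit t x -> s w \in porbit t x.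
  rewrite -!eq_porbit_mem => /eqP wx; rewrite -wx -(porbit_step t w).
  rewrite {2}/t permM; case: tpermP => [->|->|_ _]; rewrite ?eqxx //;
  by rewrite /t porbit_tperm_merge.
split; apply: porbit_closed => //; first exact: porbit_id.
by apply/eq_porbit_in/esym/porbit_tperm_merge.
Qed.

End Orbits.

Lemma porbit_image (D D' : finType) (i : D' -> D)
    (s : {perm D}) (s' : {perm D'}) :
  (forall y, s (i y) = i (s' y)) ->
  forall y, porbit s (i y) = i @: porbit s' y.
Proof.
move=> si y; have iter_si k : (s ^+ k)%g (i y) = i ((s' ^+ k)%g y).
  elim: k => [|k IHk]; first by rewrite !perm1.
  by rewrite !expgSr !permM IHk si.
apply/setP=> z; apply/porbitP/imsetP => [[k ->]|[w /porbitP[k ->] ->]].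
  by exists ((s' ^+ k)%g y); rewrite ?mem_porbit.
by exists k.
Qed.

(** Each point outside the image is fixed and so contributes one orbit and one point. *)
Lemma card_porbits_sub (D D' : finType) (i : D' -> D)
    (s : {perm D}) (s' : {perm D'}) :
  injective i -> (forall y, s (i y) = i (s' y)) ->
  (forall z, z \notin codom i -> s z = z) ->
  #|porbits s| + #|D'| = #|porbits s'| + #|D|.
Proof.
move=> inji si fixs.
have porb := porbit_image si.
have porb1 z : z \notin codom i -> porbit s z = [set z].
  move=> zi; apply/setP=> w; rewrite inE; apply/porbitP/eqP => [[k ->]|->].
    elim: k => [|k IHk]; first by rewrite perm1.
    by rewrite expgSr permM IHk fixs.
  by exists 0; rewrite perm1.
have -> : porbits s = [set i @: (A : {set D'}) | A in porbits s']
    :|: [set [set z] | z in [predC codom i]].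
  apply/setP=> A; rewrite in_setU; apply/imsetP/orP.
    case=> z _ ->; case: (boolP (z \in codom i)) => [/codomP[y ->]|zi].
      by left; rewrite porb imset_f ?imset_f.
    by right; rewrite porb1 // imset_f.
  case=> /imsetP[]; first by move=> _ /imsetP[y _ ->] ->; exists (i y).
  by move=> z zi ->; exists z; rewrite ?porb1.
rewrite cardsU card_imset; last exact: imset_inj.
rewrite (card_imset _ set1_inj).
set B := _ :&: _; have -> : B = set0.
  apply/setP=> A; rewrite !inE; apply/negP => /andP[/imsetP[_ /imsetP[y _ ->]]].
  move=> -> /imsetP[z zi] /setP/(_ (i y)).
  rewrite in_set1 imset_f ?porbit_id // => /esym/eqP iyz.
  by move: zi; rewrite !inE -iyz codom_f.
rewrite cards0 subn0 -addnA; congr (_ + _).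
by rewrite -(card_codom inji) addnC cardC.
Qed.

(* Induction on the support of [e]: multiplying [e] and [e * n] by a
   transposition changes both orbit counts by one and joins at most two labels. *)
Lemma euler_inequality (D : finType) (e n : {perm D}) :
  exists l : D -> D, [/\ forall x, l (e x) = l x, forall x, l (n x) = l x
    & #|porbits e| + #|porbits n| + #|porbits (e * n)%g|
      <= #|D| + #|codom l|.*2].
Proof.
have [k] := ubnP #|[set x | e x != x]|; elim: k e => // k IHk e.
rewrite ltnS => ek; have [e1|] := set_0Vmem [set x | e x != x].
  have {e1 ek} -> : e = 1%g.
    apply/permP=> x; rewrite perm1; apply/eqP.
    by have := in_set0 x; rewrite -e1 inE => /negbFE.
  (* The labels are representatives of the [n]-orbits, which makes the bound an equality here. The
     default is never taken, as orbits are nonempty. *)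
  pose l x := odflt x [pick y in porbit n x].
  have lorb x : l x \in porbit n x.
    by rewrite /l; case: pickP => //= y; rewrite porbit_id.
  have lP x y : porbit n x = porbit n y -> l x = l y.
    rewrite /l => ->; case: pickP => //= /(_ y); by rewrite porbit_id.
  exists l; split=> [x|x|]; first by rewrite perm1.
    by apply: lP; rewrite porbit_step.
  rewrite mul1g -addnA addnn; apply: leq_add.
    have -> : porbits (1 : {perm D}) = [set [set x] | x : D].
      apply: eq_imset => x /=; apply/setP=> w; rewrite in_set1.
      apply/porbitP/eqP => [[j ->]|->]; first by rewrite expg1n perm1.
      by exists 0; rewrite perm1.
    by rewrite (card_imset _ set1_inj).
  rewrite leq_double; have -> : porbits n = [set porbit n x | x in codom l].
    apply/setP=> A; apply/imsetP/imsetP => [[x _ ->]|[x _ ->]]; last by exists x.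
    by exists (l x); rewrite ?codom_f //; apply/esym/eq_porbit_in.
  exact: leq_imset_card.
case=> x; rewrite inE => xe.
(* [e'] fixes [x] and bypasses it in its cycle, so the support shrinks. *)
pose y := e x; have xy : x != y by rewrite eq_sym.
pose t := tperm x y; pose e' := (e * t)%g.
have e'x z : e' z = if z == x then x else if e z == x then y else e z.
  rewrite /e' permM /t; have [->|zx] := eqVneq z x; first exact: tpermR.
  have [->|ezx] := eqVneq (e z) x; first exact: tpermL.
  by rewrite tpermD // eq_sym // /y inj_eq //; apply: perm_inj.
have [|l [le ln lC]] := IHk e'.
  apply: leq_trans ek; apply: proper_card; apply/properP; split.
    apply/subsetP=> z; rewrite !inE e'x.
    have [->|zx] := eqVneq z x; rewrite ?xe //.
    by have [->|//] := eqVneq (e z) x; rewrite (eq_sym x z).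
  by exists x; rewrite !inE ?xe // e'x !eqxx.
have ce : #|porbits e'| = #|porbits e|.+1.
  by apply: porbits_tperm_split => //; rewrite /y porbit_step.
have eE : e = (e' * t)%g by rewrite /e' -mulgA tperm2 mulg1.
have lf z : l ((e' * n)%g z) = l z by rewrite permM ln le.
pose f' := (e' * n)%g.
have fE : (e * n)%g = (f' * tperm (n x) (n y))%g.
  by rewrite eE /f' -!mulgA -tpermJ /conjg !mulgA -!mulgA mulKVg.
(* With equal labels, [l] is already invariant under [e]; the orbit that [e] loses makes up for the
   at most one face gained. *)
have [lxy|lxy] := eqVneq (l x) (l y).
  exists l; split=> // [z|].
    have [->|zx] := eqVneq z x; first by rewrite lxy.
    move: (le z); rewrite e'x (negPf zx); case: eqVneq => // ->.
    by rewrite -lxy.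
  rewrite fE; have := @porbits_tperm_bound _ f' (n x) (n y).
  rewrite inj_eq ?xy; last exact: perm_inj.
  by move=> /(_ isT); move: lC; rewrite -/f' ce; lia.
(* Otherwise the two labels are identified. Then [n x] and [n y] lie on different faces of [e'], so
   one orbit of [e] and one face disappear, which pays for the lost label, counted twice. *)
pose l' z := if l z == l x then l y else l z.
exists l'; split=> [z|z|]; last 1 first.
- have f'xy : porbit f' (n x) <> porbit f' (n y).
    by move/(porbit_invariant lf); rewrite !ln => /eqP; apply/negP.
  have := porbits_tperm_merge f'xy; rewrite -fE => cf.
  suff : #|codom l| <= #|codom l'|.+1 by move: lC; rewrite -/f' ce; lia.
  apply: (@leq_trans #|[predU1 l x & codom l']|).
    apply: subset_leq_card; apply/subsetP=> _ /codomP[z ->]; rewrite !inE.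
    have [//|lz] := eqVneq (l z) (l x); rewrite /=.
    by apply/codomP; exists z; rewrite /l' (negPf lz).
  by rewrite cardU1; case: (_ \notin _) => //; rewrite add0n.
- rewrite /l'; have [->|zx] := eqVneq z x; first by rewrite eqxx -/y eq_sym (negPf lxy).
  move: (le z); rewrite e'x (negPf zx); case: eqVneq => [-> <-|_ -> //].
  by rewrite eqxx eq_sym (negPf lxy).
by rewrite /l' ln.
Qed.

(** At least two labels must occur, and one of them is set against all others. For a
    fixed-point-free involution [e] the hypothesis reads V + F > E + 2. *)
Lemma euler_disconnected (D : finType) (e n : {perm D}) :
  #|D| + 2 < #|porbits e| + #|porbits n| + #|porbits (e * n)%g| ->
  exists l : D -> bool, exists x y, [/\ forall z, l (e z) = l z,
    forall z, l (n z) = l z, l x & ~~ l y].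
Proof.
have [l [le ln lC] big] := euler_inequality e n.
have : 1 < #|codom l| by move: lC; rewrite -muln2; lia.
case/card_gt1P => _ [_ [/codomP[x ->] /codomP[y ->] xy]].
exists (fun z => l z == l x), x, y; split=> [z|z||]; rewrite ?le ?ln //.
by rewrite eq_sym.
Qed.

(** * Three-connected spherical maps *)

Lemma partition_porbits (D : finType) (s : {perm D}) :
  partition (porbits s) [set: D].
Proof.
apply/and3P; split; last 1 first.
- apply/imsetP=> -[x _ /setP/(_ x)]; by rewrite in_set0 porbit_id.
- apply/eqP/setP=> x; rewrite !inE; apply/bigcupP.
  by exists (porbit s x); rewrite ?porbit_id ?imset_f.
apply/trivIsetP=> _ _ /imsetP[x _ ->] /imsetP[y _ ->] xy.
apply/pred0P=> z /=; apply/negP => /andP[].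
rewrite -!eq_porbit_mem => /eqP zx /eqP zy.
by rewrite -zx -zy eqxx in xy.
Qed.

Lemma porbits_involution (D : finType) (e : {perm D}) :
  involutive e -> (forall x, e x != x) -> #|D| = #|porbits e|.*2.
Proof.
move=> eK ex; rewrite -cardsT (card_partition (partition_porbits e)).
rewrite (eq_bigr (fun=> 2)) => [|_ /imsetP[x _ ->]].
  by rewrite sum_nat_const muln2.
have -> : porbit e x = [set x; e x].
  apply/setP=> y; apply/idP/set2P => [|[]->]; last first.
  - by apply/eq_porbit_in; rewrite porbit_step.
  - exact: porbit_id.
  move=> yx; apply/set2P; apply: (porbit_closed (s := e)) yx => [z|].
    by case/set2P=> ->; rewrite ?eK !inE eqxx ?orbT.
  by rewrite !inE eqxx.
by rewrite cards2 eq_sym ex.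
Qed.

Lemma porbits_lower_bound (D : finType) (s : {perm D}) k :
  (forall x, k <= #|porbit s x|) -> k * #|porbits s| <= #|D|.
Proof.
move=> ks; rewrite -cardsT (card_partition (partition_porbits s)).
rewrite mulnC -sum_nat_const; apply: leq_sum => _ /imsetP[x _ ->]; exact: ks.
Qed.

(** Connectivity is used in the form that Boolean labels constant along edges are constant; such
    labels are what [euler_disconnected] delivers. *)
Lemma three_connected_label (G : sgraph) (S : {set G}) (l : G -> bool) :
  three_connected G -> #|S| < 3 ->
  (forall a b, a \notin S -> b \notin S -> adj a b -> l a = l b) ->
  forall a b, a \notin S -> b \notin S -> l a = l b.
Proof.
move=> [_ G3] /G3 cS lS a b aS bS; have /connectP[p pP ->] := cS a b aS bS.
elim: p a aS pP => //= c p IHp a aS /andP[/and3P[ac _ cS'] pP].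
by rewrite (lS a c) // (IHp c).
Qed.

Lemma three_connected_from_labels (G : sgraph) :
  3 < #|G| ->
  (forall (S : {set G}) (l : G -> bool), #|S| < 3 ->
    (forall a b, a \notin S -> b \notin S -> adj a b -> l a = l b) ->
    forall a b, a \notin S -> b \notin S -> l a = l b) ->
  three_connected G.
Proof.
move=> G3 lab; split=> // S S3 x y xS yS.
set r := [rel u v | _].
have := lab S (connect r x) S3 _ x y xS yS.
rewrite connect0 => <- // a b aS bS ab; apply/idP/idP => xa.
  by apply: connect_trans xa (connect1 _); rewrite /r /= ab aS bS.
by apply: connect_trans xa (connect1 _); rewrite /r /= adj_sym ab aS bS.
Qed.

Lemma three_connected_neighbour (G : sgraph) (S : {set G}) (u : G) :
  three_connected G -> #|S| < 3 -> exists2 v, adj u v & v \notin S.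
Proof.
(* Taking [u] out of the cut keeps it as a vertex; without a neighbour off [S'] it would be
   isolated, and the label [pred1 u] would contradict connectivity. *)
move=> G3 S3; pose S' := S :\ u.
have S'3 : #|S'| < 3 by apply: leq_ltn_trans S3; rewrite subset_leq_card ?subsetDl.
suff [v uv vS'] : exists2 v, adj u v & v \notin S'.
  exists v => //; apply: contra vS' => vS; rewrite !inE vS andbT.
  by apply: contraTneq uv => ->; rewrite adj_irr.
case: (boolP [exists (v | adj u v), v \notin S']) => [/exists_inP //|].
move/exists_inPn => nb; exfalso.
have [w wS] : exists w, w \notin u |: S'.
  have : 0 < #|~: (u |: S')|.
    have := cardsC (u |: S'); have := cardsU1 u S'; case: G3 => G4 _.
    by move: G4 S'3; case: (u \notin S') => /=; lia.
  by case/card_gt0P=> w; rewrite in_setC; exists w.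
have := @three_connected_label G S' (pred1 u) G3 S'3 _ u w.
rewrite /= eqxx !inE eqxx /=; move: wS; rewrite !inE negb_or => /andP[wu wS].
rewrite (negPf wu) in wS *; move=> H; suff : true = false by [].
apply: H => // a b; rewrite !inE => aS bS ab; apply/eqP/eqP => E; move: ab.
  by rewrite E => ub; have := nb _ ub; rewrite negbK !inE (negPf bS).
by rewrite E adj_sym => ua; have := nb _ ua; rewrite negbK !inE (negPf aS).
Qed.

(* An edge is a pair {x, e x}, the orbits of n are the vertices and those of
   e * n are the faces. The last four conditions say that a vertex occurs at
   most once on a face, that two vertices on two common faces span the edge
   between them, and that degrees and face lengths are at least 3; the whole
   list is self-dual. *)
Record polyhedral_map (D : finType) (e n : {perm D}) : Prop := PolyhedralMap {
  pm_inv : involutive e;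
  pm_fix : forall x, e x != x;
  pm_conn : forall l : D -> bool, (forall x, l (e x) = l x) ->
    (forall x, l (n x) = l x) -> forall x y, l x = l y;
  pm_euler : #|porbits n| + #|porbits (e * n)%g| = #|D|./2 + 2;
  pm_corner : forall x y, porbit n x = porbit n y ->
    porbit (e * n)%g x = porbit (e * n)%g y -> x = y;
  pm_two_faces : forall x x' y y', porbit n x = porbit n x' ->
    porbit (e * n)%g x' = porbit (e * n)%g y' -> porbit n y' = porbit n y ->
    porbit (e * n)%g y = porbit (e * n)%g x -> porbit n x <> porbit n y ->
    porbit (e * n)%g x <> porbit (e * n)%g x' -> y' = e x \/ y = e x';
  pm_degree : forall x, n (n x) != x;
  pm_length : forall x, (e * n)%g ((e * n)%g x) != x
}.

Lemma involution_mulg (D : finType) (e n : {perm D}) :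
  involutive e -> (e * (e * n))%g = n.
Proof. by move=> eK; apply/permP=> x; rewrite !permM eK. Qed.

Lemma polyhedral_map_dual (D : finType) (e n : {perm D}) :
  polyhedral_map e n -> polyhedral_map e (e * n)%g.
Proof.
case=> eK ef cn eu co tw de le; split; rewrite ?involution_mulg //.
- move=> l le' lf; apply: cn => // x.
  by rewrite -{1}[x]eK -permM lf le'.
- by rewrite addnC.
- by move=> x y fxy nxy; apply: co.
move=> x x' y y' E1 E2 E3 E4 N1 N2.
by case: (tw x y x' y') => // [->|->]; [left | right; rewrite eK].
Qed.

(** [nu] gives the start vertex of a dart. Keeping the map apart from the graph lets the same darts
    carry a polyhedron and its dual. *)
Record realizes (D : finType) (e n : {perm D}) (G : sgraph) (nu : D -> G) :
  Prop := Realizes {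
  rz_vertex : forall x y, nu x = nu y <-> porbit n x = porbit n y;
  rz_surj : forall u, exists x, nu x = u;
  rz_adj : forall u v, adj u v <-> exists x, nu x = u /\ nu (e x) = v
}.

(** * From three-connected graphs to polyhedral maps *)

Section ThreeConnectedToMap.
Variables (D : finType) (e n : {perm D}) (G : sgraph) (nu : D -> G).
Hypotheses (eK : involutive e) (rG : realizes e n nu) (G3 : three_connected G).
Hypothesis simple : forall x y, nu x = nu y -> nu (e x) = nu (e y) -> x = y.
Hypothesis euler : #|porbits n| + #|porbits (e * n)%g| = #|D|./2 + 2.

Lemma realizes_adj x : adj (nu x) (nu (e x)).
Proof. by apply/(rz_adj rG); exists x. Qed.

Lemma realizes_noloop x : nu (e x) != nu x.
Proof. by apply: contraTneq (realizes_adj x) => ->; rewrite adj_irr. Qed.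

Lemma realizes_step x : nu (n x) = nu x.
Proof. by apply/(rz_vertex rG); rewrite porbit_step. Qed.

Lemma realizes_fix x : e x != x.
Proof. by apply: contraTneq (realizes_noloop x) => ->; rewrite eqxx. Qed.

(** The rotation [n'] may cut open the vertices of [S] but agrees with [n] elsewhere, so dart labels
    descend to the vertices off [S]. *)
Lemma label_off_cut (S : {set G}) (n' : {perm D}) (l : D -> bool) :
  #|S| < 3 -> (forall z, nu z \notin S -> n' z = n z) ->
  (forall z, l (e z) = l z) -> (forall z, l (n' z) = l z) ->
  forall z z', nu z \notin S -> nu z' \notin S -> l z = l z'.
Proof.
move=> S3 n'n le ln z z' zS z'S.
pose lG u := [exists x, (nu x == u) && l x].
have lGE x : nu x \notin S -> lG (nu x) = l x.
  move=> xS; apply/existsP/idP => [[y /andP[/eqP yx ly]]|lx]; last first.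
    by exists x; rewrite eqxx.
  suff <- : l y = l x by [].
  apply: (porbit_invariant (s := n')) => //.
  have agree w : nu w \notin S -> porbit n' w = porbit n w.
    move=> wS; apply: porbit_agree => w' /eq_porbit_in/(rz_vertex rG) w'w.
    by rewrite n'n // w'w.
  by rewrite !agree ?yx //; apply/(rz_vertex rG).
rewrite -!lGE //; apply: (three_connected_label G3 S3) => // a b aS bS.
by case/(rz_adj rG)=> x [xa xb]; rewrite -xa -xb !lGE ?xa ?xb ?le.
Qed.

Lemma realizes_degree x : n (n x) != x.
Proof.
apply/negP => /eqP nnx.
have [] := @three_connected_neighbour _ [set nu (e x); nu (e (n x))] (nu x) G3.
  by rewrite cards2; case: (_ != _).
move=> v /(rz_adj rG)[z [/(rz_vertex rG)/eq_porbit_in zx <-]].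
suff /set2P[] : z \in [set x; n x] by move=> ->; rewrite !inE eqxx ?orbT.
apply: (porbit_closed (s := n)) zx => [w|]; last by rewrite !inE eqxx.
by case/set2P=> ->; rewrite ?nnx !inE eqxx ?orbT.
Qed.

Lemma realizes_degree1 x : n x != x.
Proof. by apply: contraNneq (realizes_degree x) => nx; rewrite !nx. Qed.

Lemma realizes_length x : (e * n)%g ((e * n)%g x) != x.
Proof.
set f := (e * n)%g; apply/negP => /eqP ffx.
have fx : nu (f x) = nu (e x) by rewrite /f permM realizes_step.
have efx : nu (e (f x)) = nu x by rewrite -{2}ffx {2}/f permM realizes_step.
have : f x = e x by apply: simple; rewrite ?fx ?efx ?eK.
by rewrite /f permM => /eqP; rewrite (negPf (realizes_degree1 _)).
Qed.

Lemma card_darts : #|D| = #|porbits e|.*2.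
Proof. by apply: porbits_involution eK realizes_fix. Qed.

(** If a vertex met a face in two corners, splitting it between them would add a vertex and a face.
    The map would fall apart, and this single vertex would separate the graph. *)
Lemma realizes_corner x y : porbit n x = porbit n y ->
  porbit (e * n)%g x = porbit (e * n)%g y -> x = y.
Proof.
move=> nxy fxy; apply/eqP/negPn/negP => xy.
have := porbits_tperm_split xy nxy; have := porbits_tperm_split xy fxy.
rewrite -mulgA; set n' := (n * _)%g => cf cn.
have [|l [x0 [y0 [le ln lx ly]]]] := @euler_disconnected D e n'.
  by rewrite cf cn; have := euler; have := card_darts; rewrite -!muln2; lia.
(* A dart starting at the cut vertex is replaced by its reverse, which has the same label and starts
   elsewhere. *)
pose out z := if nu z == nu x then e z else z.
have outP z : nu (out z) \notin [set nu x] /\ l (out z) = l z.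
  rewrite /out; have [zx|zx] := eqVneq (nu z) (nu x); rewrite inE ?zx //.
  by rewrite -zx realizes_noloop le.
have [ox lox] := outP x0; have [oy loy] := outP y0.
move: ly; rewrite -loy -(@label_off_cut [set nu x] n' l _ _ le ln _ _ ox oy).
- by rewrite lox lx.
- by rewrite cards1.
move=> z; rewrite inE /n' permM => zx; rewrite tpermD //.
  by apply: contraNneq zx => E; rewrite E realizes_step.
apply: contraNneq zx => E; rewrite -(realizes_step z) -E.
by apply/eqP/(rz_vertex rG).
Qed.

(** Both vertices are split at their corners on the two faces. The map falls apart, so the two
    vertices separate the graph unless one piece is just an edge between them. *)
Lemma realizes_two_faces x x' y y' : porbit n x = porbit n x' ->
  porbit (e * n)%g x' = porbit (e * n)%g y' -> porbit n y' = porbit n y ->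
  porbit (e * n)%g y = porbit (e * n)%g x -> porbit n x <> porbit n y ->
  porbit (e * n)%g x <> porbit (e * n)%g x' -> y' = e x \/ y = e x'.
Proof.
move=> nxx' fxy' nyy' fyx nxy fxx'; set f := (e * n)%g in fxy' fyx fxx'.
have xx' : x != x' by apply/eqP => E; apply: fxx'; rewrite E.
have yy' : y != y' by apply/eqP => E; apply: fxx'; rewrite -fyx fxy' E.
have Vxx' : nu x = nu x' by apply/(rz_vertex rG).
have Vyy' : nu y = nu y' by apply/(rz_vertex rG).
have Vxy : nu x != nu y by apply/eqP => /(rz_vertex rG).
pose n1 := (n * tperm x x')%g; pose n' := (n1 * tperm y y')%g.
have n'x z : nu z = nu x -> n' z = tperm x x' (n z).
  move=> zx; rewrite /n' permM [n1 _]permM.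
  have : nu (tperm x x' (n z)) = nu x.
    by case: tpermP => // _ _; rewrite realizes_step.
  move=> E; rewrite tpermD //; apply: contraNneq Vxy => E'; rewrite -E -E' //.
  by rewrite Vyy'.
have n1E z : nu z != nu x -> n1 z = n z.
  move=> zx; rewrite /n1 permM tpermD //; apply: contraNneq zx => E.
    by rewrite -(realizes_step z) -E.
  by rewrite -(realizes_step z) -E Vxx'.
have n'y z : nu z = nu y -> n' z = tperm y y' (n z).
  by move=> zy; rewrite /n' permM n1E // zy eq_sym.
have n'E z : nu z \notin [set nu x; nu y] -> n' z = n z.
  rewrite !inE negb_or => /andP[zx zy]; rewrite /n' permM n1E // tpermD //.
    by apply: contraNneq zy => E; rewrite -(realizes_step z) -E.
  by apply: contraNneq zy => E; rewrite -(realizes_step z) -E Vyy'.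
have cn1 : #|porbits n1| = #|porbits n|.+1 by apply: porbits_tperm_split.
have cn' : #|porbits n'| = #|porbits n|.+2.
  rewrite -cn1; apply: porbits_tperm_split => //.
  have agree z : nu z = nu y -> porbit n1 z = porbit n z.
    move=> zy; apply: porbit_agree => w /eq_porbit_in/(rz_vertex rG) wz.
    by rewrite n1E // wz zy eq_sym.
  by rewrite !agree // Vyy'.
(* The first transposition merges the two faces, the second splits the result; only the vertex count
   grows, by two. *)
have cf : #|porbits (e * n')%g| = #|porbits f|.
  rewrite /n' /n1 !mulgA -/f -(porbits_tperm_merge fxx').
  apply: porbits_tperm_split => //.
  by rewrite !(porbit_tperm_merge_sub fxx') //; [right | left].
have [|l [x0 [y0 [le ln lx ly]]]] := @euler_disconnected D e n'.
  by rewrite cf cn'; have := euler; have := card_darts; rewrite -!muln2 -/f; lia.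
have small : #|[set nu x; nu y]| < 3 by rewrite cards2; case: (_ != _).
have n'V z : nu (n' z) = nu z.
  have [zS|/n'E ->] := boolP (nu z \in [set nu x; nu y]); last exact: realizes_step.
  case/set2P: zS => E; rewrite ?(n'x _ E) ?(n'y _ E);
  by case: tpermP => [_|_|_ _]; rewrite ?realizes_step // E.
(* Here [z] and [e z] form a whole piece: each is alone at its split vertex, hence is one of the
   four given corners. *)
have fixed z : nu z = nu x -> n' z = z -> n' (e z) = e z -> nu (e z) = nu y ->
    y' = e x \/ y = e x'.
  move=> zx n'z n'ez ezy; move: n'z n'ez; rewrite n'x // n'y //.
  have tp a b w : tperm a b (n w) = w -> (n w = a /\ w = b) \/ (n w = b /\ w = a).
    case: tpermP => [-> <-|-> <-|_ _ /eqP]; [by left | by right |].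
    by rewrite (negPf (realizes_degree1 _)).
  have fE w : porbit f (n (e w)) = porbit f w by rewrite -permM porbit_step.
  case/tp=> [] [nz zE] /tp[] [nez ezE].
  - by left; exfalso; apply: fxx'; rewrite -fyx -nez fE zE.
  - by right; rewrite -ezE zE.
  - by left; rewrite -ezE zE.
  by left; exfalso; apply: fxx'; rewrite fxy' -nez fE zE.
(* If [z], [e z] and the heads of their successors all stay in the cut, simplicity makes [z] and
   [e z] fixed points of [n']. *)
have outside z : (y' = e x \/ y = e x') \/
    exists2 z', nu z' \notin [set nu x; nu y] & l z' = l z.
  have [zS|zS] := boolP (nu z \in [set nu x; nu y]); last by right; exists z.
  have [ezS|ezS] := boolP (nu (e z) \in [set nu x; nu y]); last first.
    by right; exists (e z).
  have [ezS'|ezS'] := boolP (nu (e (n' z)) \in [set nu x; nu y]); last first.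
    by right; exists (e (n' z)); rewrite ?le ?ln.
  have [zS'|zS'] := boolP (nu (e (n' (e z))) \in [set nu x; nu y]); last first.
    by right; exists (e (n' (e z))); rewrite ?le ?ln ?le.
  have same a b : nu a = nu b -> nu a \in [set nu x; nu y] ->
      nu (e a) \in [set nu x; nu y] -> nu (e b) \in [set nu x; nu y] -> a = b.
    move=> ab aS eaS ebS; apply: simple => //.
    have := realizes_noloop a; have := realizes_noloop b; rewrite -ab.
    by case/set2P: aS eaS ebS => -> /set2P[]-> /set2P[]->; rewrite ?eqxx.
  have n'z : n' z = z by apply: same; rewrite ?n'V.
  have n'ez : n' (e z) = e z by apply: same; rewrite ?n'V ?eK.
  left; case/set2P: (zS) => zx; case/set2P: (ezS) => ezx.
  - by have := realizes_noloop z; rewrite zx ezx eqxx.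
  - exact: (fixed z).
  - by apply: (fixed (e z)); rewrite ?eK.
  - by have := realizes_noloop z; rewrite zx ezx eqxx.
case: (outside x0) => // -[zx zxS lzx]; case: (outside y0) => // -[zy zyS lzy].
move: ly; rewrite -lzy -(@label_off_cut _ n' l small n'E le ln _ _ zxS zyS).
by rewrite lzx lx.
Qed.

Lemma realizes_connected l : (forall x, l (e x) = l x) ->
  (forall x, l (n x) = l x) -> forall x y : D, l x = l y :> bool.
Proof.
move=> le ln x y; apply: (@label_off_cut set0 n l) => //; rewrite ?cards0 ?inE //.
Qed.

Lemma polyhedral_of_three_connected : polyhedral_map e n.
Proof.
split=> //.
- exact: realizes_fix.
- exact: realizes_connected.
- exact: realizes_corner.
- exact: realizes_two_faces.
- exact: realizes_degree.
- exact: realizes_length.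
Qed.

End ThreeConnectedToMap.

(** * From maps to three-connected graphs *)

Lemma card_realized (D : finType) (e n : {perm D}) (G : sgraph) (nu : D -> G) :
  realizes e n nu -> #|G| = #|porbits n|.
Proof.
move=> rG; pose fib u := [set x | nu x == u].
have fib_inj : injective fib.
  move=> u v /setP uv; have [x xu] := rz_surj rG u.
  by move: (uv x); rewrite !inE xu eqxx => /esym/eqP.
rewrite -cardsT -(card_imset _ fib_inj); apply: eq_card => A.
have fibE x : fib (nu x) = porbit n x.
  apply/setP=> y; rewrite inE; apply/eqP/idP => [/(rz_vertex rG)/eq_porbit_in //|].
  by move/eq_porbit_in/(rz_vertex rG).
apply/imsetP/imsetP => [[u _ ->]|[x _ ->]].
  by have [x <-] := rz_surj rG u; exists x.
by exists (nu x).
Qed.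

(** The isomorphism [phi] is part of the conclusion because the dual and the vertex expansion are
    later read off along it. *)
Lemma sphere_embedding_exists (D : finType) (e n : {perm D}) (G : sgraph)
    (nu : D -> G) :
  connected G -> realizes e n nu ->
  (forall x y, nu x = nu y -> nu (e x) = nu (e y) -> x = y) ->
  involutive e ->
  #|porbits n| + #|porbits (e * n)%g| = #|D|./2 + 2 ->
  exists s : {perm dart G}, exists phi : D -> dart G,
    [/\ bijective phi, forall x, phi (e x) = drev (phi x),
        forall x, phi (n x) = s (phi x), forall x, src (phi x) = nu x
      & sphere_embedding s].
Proof.
move=> cG rG simple eK euler.
have nuadj x : adj (nu x) (nu (e x)) by apply/(rz_adj rG); exists x.
pose phi x : dart G := Sub (nu x, nu (e x)) (nuadj x).
have phi_inj : injective phi.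
  by move=> x y /(congr1 val)[]; apply: simple.
have phi_surj d : exists x, phi x == d.
  case: d => -[u v] uv; have /(rz_adj rG)[x [xu xv]] := uv.
  by exists x; apply/eqP/val_inj; rewrite /= xu xv.
pose psi d := xchoose (phi_surj d).
have psiK : cancel psi phi by move=> d; apply/eqP/(xchooseP (phi_surj d)).
have phiK : cancel phi psi by apply: inj_can_sym psiK phi_inj.
have s_inj : injective (phi \o n \o psi).
  by apply: inj_comp (can_inj psiK); apply: inj_comp phi_inj perm_inj.
pose s := perm s_inj.
have sE x : s (phi x) = phi (n x) by rewrite permE /= phiK.
have eE x : phi (e x) = drev (phi x) by apply: val_inj; rewrite /= eK.
exists s, phi; split=> //; first by exists psi.
have in_codom z : z \notin codom phi -> False.
  by rewrite -[z]psiK codom_f.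
split=> //.
  move=> d; rewrite -[d]psiK (porbit_image sE); apply/setP=> d'; rewrite inE.
  apply/imsetP/eqP => [[x /eq_porbit_in/(rz_vertex rG) xd ->]//|dd'].
  exists (psi d'); rewrite ?psiK //; apply/eq_porbit_in/(rz_vertex rG).
  by move: dd'; rewrite -{1}[d']psiK.
have -> : #|faces s| = #|porbits (e * n)%g|.
  have H := @card_porbits_sub _ _ phi (drev_perm G * s)%g (e * n)%g phi_inj.
  apply/eqP; rewrite -(eqn_add2r #|D|) H.
  - by rewrite (bij_eq_card (Bijective phiK psiK)).
  - by move=> y; rewrite !permM [drev_perm G _]permE -eE sE.
  - by move=> z /in_codom.
have <- : #|D| = #|dart G| by apply: bij_eq_card (Bijective phiK psiK).
by rewrite (card_realized rG).
Qed.

Section MapToThreeConnected.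
Variables (D : finType) (e n : {perm D}).
Hypothesis pm : polyhedral_map e n.
Local Notation f := (e * n)%g.

Lemma pm_face_step x : f x = n (e x).
Proof. exact: permM. Qed.

Lemma pm_degree1 x : n x != x.
Proof. by apply: contraNneq (pm_degree pm x) => nx; rewrite !nx. Qed.

Lemma pm_length1 x : f x != x.
Proof. by apply: contraNneq (pm_length pm x) => fx; rewrite !fx. Qed.

Lemma pm_porbit_face x : porbit n (f x) = porbit n (e x).
Proof. by rewrite pm_face_step porbit_step. Qed.

Lemma pm_face_next x : porbit f (n x) = porbit f (e x).
Proof. by rewrite -[in LHS](pm_inv pm x) -pm_face_step porbit_step. Qed.

Lemma pm_noloop x : porbit n (e x) <> porbit n x.
Proof.
move=> E; have := pm_length1 x; rewrite (_ : f x = x) ?eqxx //.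
by apply: (pm_corner pm); rewrite ?porbit_step // pm_porbit_face.
Qed.

(** By the two-face condition, applied to the faces of [x], [y] and to those of [e x], [e y],
    parallel edges are consecutive at both ends. This closes up a face of length 2 or a vertex of
    degree 2. *)
Lemma pm_simple x y : porbit n x = porbit n y ->
  porbit n (e x) = porbit n (e y) -> x = y.
Proof.
have half a b : porbit n a = porbit n b -> n (e b) = e a ->
    b = n a \/ a = n b -> False.
  move=> nab nba [E|E].
    by have := pm_length pm b; rewrite !pm_face_step nba (pm_inv pm) E eqxx.
  have fba : porbit f b = porbit f (n a).
    by rewrite pm_face_next -nba -pm_face_step porbit_step.
  have bE : b = n a by apply: (pm_corner pm) => //; rewrite porbit_step.
  by have := pm_degree pm b; rewrite -E -bE eqxx.
move=> nxy exy; apply/eqP/negPn/negP => /eqP xy.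
have fxy : porbit f x <> porbit f y by move=> E; apply: xy; apply: (pm_corner pm).
have A1 : n (e y) = e x \/ n (e x) = e y.
  have [] := pm_two_faces pm (x := x) (x' := y) (y := f x) (y' := f y).
  - exact: nxy.
  - by rewrite porbit_step.
  - by rewrite !pm_porbit_face.
  - by rewrite porbit_step.
  - by rewrite pm_porbit_face => E; apply: (@pm_noloop x).
  - exact: fxy.
  - by rewrite pm_face_step; left.
  by rewrite pm_face_step; right.
have A2 : y = n x \/ x = n y.
  have [] := pm_two_faces pm (x := n x) (x' := n y) (y := e x) (y' := e y).
  - by rewrite !porbit_step.
  - by rewrite pm_face_next.
  - by rewrite exy.
  - by rewrite pm_face_next.
  - by rewrite porbit_step => E; apply: (@pm_noloop x).
  - by move=> /(pm_corner pm) H; apply: xy; apply: perm_inj (H _); rewrite !porbit_step.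
  - by move/(can_inj (pm_inv pm)); left.
  by move/(can_inj (pm_inv pm)); right.
case: A1 => A1; first exact: half A2.
by apply: half A1 _ => //; case: A2; auto.
Qed.

Variables (G : sgraph) (nu : D -> G).
Hypothesis rG : realizes e n nu.

Lemma realizes_simple x y : nu x = nu y -> nu (e x) = nu (e y) -> x = y.
Proof. by move=> /(rz_vertex rG) ? /(rz_vertex rG) ?; apply: pm_simple. Qed.

Lemma pm_nu_next x : nu (n x) = nu x.
Proof. by apply/(rz_vertex rG); rewrite porbit_step. Qed.

Lemma pm_nu_face x : nu (f x) = nu (e x).
Proof. by rewrite pm_face_step pm_nu_next. Qed.

Lemma pm_nu_noloop x : nu (e x) != nu x.
Proof. by apply/eqP => /(rz_vertex rG); apply: pm_noloop. Qed.

Lemma pm_nu_adj x : adj (nu x) (nu (e x)).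
Proof. by apply/(rz_adj rG); exists x. Qed.

Lemma pm_nu_corner x y : nu x = nu y -> porbit f x = porbit f y -> x = y.
Proof. by move/(rz_vertex rG); apply: (pm_corner pm). Qed.

Lemma pm_dart : exists x : D, true.
Proof.
have [x _|D0] := pickP D; first by exists x.
have card0 (s : {perm D}) : #|porbits s| = 0.
  apply/eqP; rewrite cards_eq0; apply/eqP/setP=> A; rewrite inE; apply/negP.
  by case/imsetP=> x; have := D0 x.
by have := pm_euler pm; rewrite !card0 addn2.
Qed.

Lemma label_const (l : G -> bool) :
  (forall a b, adj a b -> l a = l b) -> forall a b, l a = l b.
Proof.
move=> lab a b; have [x <-] := rz_surj rG a; have [y <-] := rz_surj rG b.
apply: (pm_conn pm (l := l \o nu)) => z /=; last by rewrite pm_nu_next.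
by rewrite (lab _ _ (pm_nu_adj z)).
Qed.

(* Walking along the face of y from one neighbour of the vertex to the next. *)
Lemma label_around (S : {set G}) (l : G -> bool) y :
  (forall a b, a \notin S -> b \notin S -> adj a b -> l a = l b) ->
  (forall w, porbit f w = porbit f y -> w != y -> nu w \notin S) ->
  l (nu (e y)) = l (nu (e (n^-1%g y))).
Proof.
move=> lab off; rewrite -pm_nu_face.
have fz : f (e (n^-1%g y)) = y by rewrite pm_face_step (pm_inv pm) permKV.
set z := e _ in fz *.
pose A := [pred w | (porbit f w == porbit f y) && ((w == y) || (l (nu w) == l (nu (f y))))].
have zA : z \in A.
  apply: (porbit_closed (s := f) (x := y)) => [w||].
  - rewrite !inE => /andP[wy wl]; rewrite porbit_step wy /=.
    have [//|fwy] /= := eqVneq (f w) y.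
    have [->|wny] := eqVneq w y; first by rewrite eqxx.
    move: wl; rewrite (negPf wny) /= => /eqP <-; apply/eqP/esym/lab.
    + by apply: off => //; apply/eqP.
    + by apply: off => //; apply/eqP; rewrite porbit_step.
    by rewrite pm_nu_face pm_nu_adj.
  - by rewrite !inE !eqxx.
  by apply/eq_porbit_in; rewrite -fz porbit_step.
move: zA; rewrite !inE => /andP[_ /orP[/eqP zy|/eqP //]].
by have := pm_length1 z; rewrite fz zy eqxx.
Qed.

(** Each face meets [u] only once, so walking along the faces around [u] gives all its neighbours
    one label. With that label assigned to [u], connectedness applies. *)
Lemma label_const_off1 u (l : G -> bool) :
  (forall a b, a != u -> b != u -> adj a b -> l a = l b) ->
  forall a b, a != u -> b != u -> l a = l b.
Proof.
move=> lab a b au bu; have [x0 x0u] := rz_surj rG u.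
pose c := l (nu (e x0)).
have around x : nu x = u -> l (nu (e x)) = c.
  move=> xu; pose A := [pred y | (nu y == u) && (l (nu (e y)) == c)].
  suff : x \in A by rewrite inE => /andP[_ /eqP].
  apply: (porbit_closed (s := n) (x := x0)) => [z||].
  - rewrite !inE pm_nu_next => /andP[/eqP zu /eqP <-].
    rewrite zu eqxx (@label_around [set u] l (n z)) ?permK ?eqxx //.
      by move=> a' b'; rewrite !inE; apply: lab.
    move=> w wz; rewrite inE; apply: contra => /eqP wu; apply/eqP.
    by apply: pm_nu_corner; rewrite // pm_nu_next wu.
  - by rewrite inE x0u !eqxx.
  by apply/eq_porbit_in/(rz_vertex rG); rewrite xu.
pose l' v := if v == u then c else l v.
have := @label_const l' _ a b; rewrite /l' (negPf au) (negPf bu); apply.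
move=> a' b' ab; have [a'u|a'u] := eqVneq a' u; have [b'u|b'u] := eqVneq b' u.
- by [].
- move: ab; rewrite a'u => /(rz_adj rG)[z [zu <-]]; by rewrite around.
- move: ab; rewrite b'u adj_sym => /(rz_adj rG)[z [zu <-]]; by rewrite around.
exact: lab.
Qed.

Let faces_both w y := [exists y', (nu y' == w) && (porbit f y' == porbit f y)].

(** This limits the faces at [u] that also pass through [w], which are the only places where a label
    can change around [u]. *)
Lemma faces_both_edge u w y1 y2 : u != w -> nu y1 = u -> nu y2 = u ->
  faces_both w y1 -> faces_both w y2 -> y1 != y2 ->
  nu (e y1) = w \/ nu (e y2) = w.
Proof.
move=> uw y1u y2u /existsP[z1 /andP[/eqP z1w /eqP z1f]].
move=> /existsP[z2 /andP[/eqP z2w /eqP z2f]] y12.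
have [] := pm_two_faces pm (x := y1) (x' := y2) (y := z1) (y' := z2).
- by apply/(rz_vertex rG); rewrite y1u y2u.
- by [].
- by apply/(rz_vertex rG); rewrite z1w z2w.
- by [].
- by move/(rz_vertex rG); rewrite y1u z1w => /eqP; apply/negP.
- by move/(pm_nu_corner _) => H; move: y12; rewrite H ?eqxx // y1u y2u.
- by move=> <-; left.
by move=> <-; right.
Qed.

(** Around [u] the labels change at most at one face, or at the two faces beside an edge to [w]. A
    cyclic sequence cannot change exactly once, so the neighbours of [u] other than [w] agree,
    against [attach]. *)
Lemma label_const_off2 u w (l : G -> bool) : u != w ->
  (forall a b, a \notin [set u; w] -> b \notin [set u; w] -> adj a b -> l a = l b) ->
  forall a b, a \notin [set u; w] -> b \notin [set u; w] -> l a = l b.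
Proof.
move=> uw lab a b aS bS; apply/eqP/negPn/negP => lab'.
have off v : v \notin [set u; w] -> v != u /\ v != w.
  by rewrite !inE negb_or => /andP[].
have [[au aw] [bu bw]] := (off _ aS, off _ bS).
(* If no neighbour off [w] had label [c], giving [u] the label [~~ c] would contradict
   [label_const_off1] at [w]. *)
have attach c : exists x, [/\ nu x = u, nu (e x) != w & l (nu (e x)) = c].
  pose P x := [&& nu x == u, nu (e x) != w & l (nu (e x)) == c].
  have [x /and3P[/eqP xu xw /eqP lx]|no] := pickP P; first by exists x.
  exfalso; pose l' v := if v == u then ~~ c else l v.
  have l'u v : adj u v -> v != w -> l' v = ~~ c.
    rewrite /l'; have [//|_] := eqVneq v u.
    move=> /(rz_adj rG)[x [xu xv]] vw.
    have := no x; rewrite /P xu xv eqxx vw /= => /negbT.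
    by case: (l v); case: (c).
  have l'lab p q : p != w -> q != w -> adj p q -> l' p = l' q.
    move=> pw qw pq.
    have [pu|pu] := eqVneq p u; first by rewrite [RHS]l'u -?pu // /l' pu eqxx.
    have [qu|qu] := eqVneq q u.
      by rewrite [LHS]l'u -?qu 1?adj_sym // /l' qu eqxx.
    rewrite /l' (negPf pu) (negPf qu); apply: lab; rewrite // !inE negb_or ?pu ?qu //.
  have H v : v != w -> l' v = ~~ c.
    by move=> vw; rewrite (label_const_off1 l'lab vw uw) /l' eqxx.
  have := H a aw; have := H b bw; rewrite /l' (negPf au) (negPf bu) => lb la.
  by rewrite la lb eqxx in lab'.
have nonbreak y : nu y = u -> ~~ faces_both w y ->
    l (nu (e y)) = l (nu (e (n^-1%g y))).
  move=> yu nb; apply: (@label_around [set u; w]) => // z zy zny.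
  rewrite !inE negb_or; apply/andP; split.
    by apply: contra zny => /eqP zu; apply/eqP/pm_nu_corner; rewrite ?yu.
  by apply: contra nb => zw; apply/existsP; exists z; rewrite zw zy eqxx.
have cyc (L : D -> bool) d : nu d = u ->
    (forall y, nu y = u -> y != d -> L y = L (n^-1%g y)) ->
    forall y, nu y = u -> L y = L d.
  move=> du Ld y yu; pose A := [pred z | (nu z == u) && (L z == L d)].
  suff : y \in A by rewrite inE => /andP[_ /eqP].
  apply: (porbit_closed (s := n) (x := d)) => [z||].
  - rewrite !inE pm_nu_next => /andP[/eqP zu /eqP lz]; rewrite zu eqxx /=.
    have [->//|nzd] := eqVneq (n z) d.
    by rewrite Ld ?permK ?lz // pm_nu_next.
  - by rewrite inE du !eqxx.
  by apply/eq_porbit_in/(rz_vertex rG); rewrite yu.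
have [x [xu xw lx]] := attach true; have [y [yu yw ly]] := attach false.
suff : l (nu (e x)) = l (nu (e y)) by rewrite lx ly.
have [d /andP[/eqP du /eqP dw]|noedge] := pickP (fun d => (nu d == u) && (nu (e d) == w)).
  (* The head of [d] is the cut vertex [w] and has no useful label; [d] borrows that of [n d], which
     leaves only one possible change. *)
  pose L z := if z == d then l (nu (e (n d))) else l (nu (e z)).
  have LE z : nu (e z) != w -> L z = l (nu (e z)).
    by rewrite /L; have [->|//] := eqVneq z d; rewrite dw eqxx.
  rewrite -!LE //; suff H z : nu z = u -> L z = L d by rewrite !H.
  apply: cyc => // {}z zu zd; rewrite /L (negPf zd).
  have [E|zd'] := eqVneq (n^-1%g z) d; first by rewrite -E permKV.
  apply: nonbreak => //; apply/negP => bz.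
  have znd : z != n d by apply: contraNneq zd' => ->; rewrite permK.
  have bnd : faces_both w (n d).
    by apply/existsP; exists (e d); rewrite dw pm_face_next !eqxx.
  have [|E|E] := faces_both_edge uw zu _ bz bnd znd.
  - by rewrite pm_nu_next.
  - by move: zd; rewrite (@realizes_simple z d) ?eqxx ?zu ?du ?E ?dw.
  have := pm_degree1 d; rewrite (@realizes_simple (n d) d) ?eqxx ?E ?dw //.
  exact: pm_nu_next.
have noe z : nu z = u -> nu (e z) <> w.
  by move=> zu zw; have := noedge z; rewrite zu zw !eqxx.
pose L z := l (nu (e z)).
have [d /andP[/eqP du bd]|nobreak] := pickP (fun d => (nu d == u) && faces_both w d).
  suff H z : nu z = u -> L z = L d by rewrite -/(L x) -/(L y) !H.
  apply: cyc => // {}z zu zd; apply: nonbreak => //; apply/negP => bz.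
  by have [E|E] := faces_both_edge uw zu du bz bd zd; [apply: (noe z) | apply: (noe d)].
apply: (cyc L) => // z zu _; apply: nonbreak => //.
by have := nobreak z; rewrite zu eqxx => /negbT.
Qed.

Lemma three_connected_of_polyhedral : three_connected G.
Proof.
apply: three_connected_from_labels.
  have [x _] := pm_dart.
  pose s := [:: nu x; nu (e x); nu (e (n x)); nu (e (n (n x)))].
  suff us : uniq s by rewrite (leq_trans _ (max_card [in s])) // (card_uniqP us).
  have neq a b : nu a = nu b -> a != b -> nu (e a) != nu (e b).
    by move=> ab; apply: contraNneq => E; apply/eqP/realizes_simple.
  have nl y : nu y = nu x -> nu x != nu (e y).
    by move=> <-; rewrite eq_sym pm_nu_noloop.
  rewrite /= !inE !negb_or !nl ?neq ?pm_nu_next //.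
  - by rewrite eq_sym pm_degree1.
  - by rewrite eq_sym (pm_degree pm).
  by rewrite eq_sym pm_degree1.
move=> S l S3 lab a b.
have : #|S| <= 2 by [].
rewrite leq_eqVlt => /orP[/cards2P[u [w [uw SE]]]|].
  by rewrite SE => aS bS; rewrite SE in lab; apply: (label_const_off2 uw lab).
rewrite ltnS leq_eqVlt => /orP[/cards1P[u SE]|].
  rewrite SE !inE => au bu; apply: (@label_const_off1 u) => // p q pu qu; rewrite SE in lab.
  by apply: lab; rewrite inE.
rewrite ltnS leqn0 cards_eq0 => /eqP SE _ _; apply: label_const => p q.
by apply: lab; rewrite SE inE.
Qed.

End MapToThreeConnected.

(** * Deleting an edge *)

Section DeleteEdge.
Variables (G : sgraph) (p q : G).

Definition del_edge_adj (u v : G) : bool :=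
  adj u v && ~~ ((u \in [set p; q]) && (v \in [set p; q])).

Fact del_edge_sym : symmetric del_edge_adj.
Proof. by move=> u v; rewrite /del_edge_adj adj_sym [X in ~~ X]andbC. Qed.

Fact del_edge_irr : irreflexive del_edge_adj.
Proof. by move=> u; rewrite /del_edge_adj adj_irr. Qed.

Definition del_edge : sgraph := SGraph del_edge_sym del_edge_irr.

End DeleteEdge.

Lemma restrict_perm (D : finType) (P : pred D) (s : {perm D}) :
  (forall z, P z -> P (s z)) ->
  exists s' : {perm {z | P z}}, forall z, val (s' z) = s (val z).
Proof.
move=> sP; pose r (z : {z | P z}) : {z | P z} := insubd z (s (val z)).
have rE z : val (r z) = s (val z) by rewrite val_insubd sP // (valP z).
have r_inj : injective r.
  by move=> y z /(congr1 val); rewrite !rE => /perm_inj/val_inj.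
by exists (perm r_inj) => z; rewrite permE.
Qed.

(* When the edge of x is deleted, the rotation becomes [skip x \o n]. *)
Definition skip (D : finType) (e n : {perm D}) (x w : D) : D :=
  if w == x then n x else if w == e x then n (e x) else w.

Section Deletion.
Variables (D : finType) (e n : {perm D}).
Hypothesis pm : polyhedral_map e n.
Variable x : D.
Local Notation f := (e * n)%g.
Local Notation D' := {y : D | y \notin [set x; e x]}.
Local Notation g := (skip e n x).

Lemma mem_kept w : (w \notin [set x; e x]) = (w != x) && (w != e x).
Proof. by rewrite !inE negb_or. Qed.

Lemma kept_dart (y : D') : (val y != x) && (val y != e x).
Proof. by rewrite -mem_kept (valP y). Qed.

Lemma kept_inv w : w \notin [set x; e x] -> e w \notin [set x; e x].
Proof.
rewrite !mem_kept => /andP[wx wex]; rewrite (inj_eq perm_inj) wx.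
by rewrite andbT -{1}[x](pm_inv pm) (inj_eq perm_inj) wex.
Qed.

Lemma pm_noloop_step w : n w != e w.
Proof.
by apply/eqP=> E; apply: (pm_noloop pm (x := w)); rewrite -E porbit_step.
Qed.

Lemma skip_kept w : g w \notin [set x; e x].
Proof.
rewrite /skip mem_kept; have [_|wx] := eqVneq w x.
  by rewrite (pm_degree1 pm) pm_noloop_step.
have [_|wex] := eqVneq w (e x); last by rewrite wx wex.
by rewrite (pm_degree1 pm) andbT -{2}[x](pm_inv pm) pm_noloop_step.
Qed.

Lemma skip_id w : w \notin [set x; e x] -> g w = w.
Proof. by rewrite mem_kept /skip => /andP[/negPf-> /negPf->]. Qed.

Lemma porbit_skip w : porbit n (g w) = porbit n w.
Proof.
rewrite /skip; have [->|_] := eqVneq w x; first exact: porbit_step.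
by have [->|//] := eqVneq w (e x); apply: porbit_step.
Qed.

(** Along the old orbit a deleted dart is represented by its successor, so the induction passes over
    [x] and [e x]. *)
Lemma porbit_deleted (n' : {perm D'}) :
  (forall y, val (n' y) = g (n (val y))) ->
  forall y z, porbit n' y = porbit n' z <-> porbit n (val y) = porbit n (val z).
Proof.
move=> n'E y z; split=> [|/eq_porbit_in yz].
  apply: (porbit_invariant (g := fun w : D' => porbit n (val w))) => w.
  by rewrite n'E porbit_skip porbit_step.
pose A := [pred w | [exists y', (val y' == g w) && (porbit n' y' == porbit n' z)]].
suff : val y \in A.
  rewrite inE skip_id; last exact: (valP y).
  by case/existsP=> y' /andP[/eqP/val_inj<- /eqP].
apply: (porbit_closed (s := n) (x := val z)) yz => [w|]; last first.
  by rewrite inE; apply/existsP; exists z; rewrite skip_id ?(valP z) ?eqxx.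
rewrite !inE => /existsP[y' /andP[/eqP y'w /eqP y'z]].
have [wS|wS] := boolP (w \in [set x; e x]); last first.
  apply/existsP; exists (n' y'); rewrite porbit_step y'z eqxx andbT.
  by rewrite n'E y'w (skip_id wS) eqxx.
apply/existsP; exists y'; rewrite y'z y'w eqxx andbT; apply/eqP.
have nx : n x \notin [set x; e x].
  by rewrite mem_kept (pm_degree1 pm) pm_noloop_step.
have nex : n (e x) \notin [set x; e x].
  by rewrite mem_kept (pm_degree1 pm) andbT -{2}[x](pm_inv pm) pm_noloop_step.
case/set2P: wS => ->; rewrite [RHS]skip_id // /skip ?eqxx //.
by rewrite (negPf (pm_fix pm x)).
Qed.

Lemma deletion_map : exists e' n' : {perm D'},
  [/\ forall y, val (e' y) = e (val y), forall y, val (n' y) = g (n (val y))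
    & #|porbits n'| + #|porbits (e' * n')%g| = #|{: D'}|./2 + 2 ].
Proof.
have eK := pm_inv pm.
have ex : e x != x by apply: (pm_fix pm).
have [e' e'E] := restrict_perm (P := fun w => w \notin [set x; e x]) kept_inv.
(* Two transpositions make [x] and [e x] fixed points of the rotation, adding two vertices; on the
   faces they first merge the two sides of the edge and then split off the face consisting of [x]
   and [e x]. *)
pose t1 := tperm x (n x); pose n1 := (n * t1)%g.
have n1x : n1 x = x by rewrite permM /t1 tpermR.
have n1ex : n1 (e x) = n (e x).
  rewrite permM /t1 tpermD // 1?eq_sym.
    by rewrite -{2}[x]eK pm_noloop_step.
  by rewrite (inj_eq perm_inj).
pose t2 := tperm (e x) (n1 (e x)); pose n2 := (n1 * t2)%g.
have n2x : n2 x = x.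
  rewrite permM n1x /t2 tpermD // -{2}n1x (inj_eq perm_inj) //.
have n2ex : n2 (e x) = e x by rewrite permM /t2 tpermR.
have n2E w : w \notin [set x; e x] -> n2 w = g (n w).
  rewrite mem_kept => /andP[wx wex].
  rewrite /n2 permM /t2 n1ex /n1 permM /t1 /skip.
  have [->|nwx] := eqVneq (n w) x.
    rewrite tpermL tpermD //; first by rewrite eq_sym pm_noloop_step.
    by rewrite (inj_eq perm_inj).
  rewrite [tperm x _ _]tpermD 1?eq_sym //; last by rewrite (inj_eq perm_inj).
  have [->|nwex] := eqVneq (n w) (e x); first by rewrite tpermL.
  by rewrite tpermD 1?eq_sym // (inj_eq perm_inj).
have [n' n'E] : exists n' : {perm D'}, forall y, val (n' y) = n2 (val y).
  by apply: restrict_perm => w wS; rewrite n2E ?skip_kept.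
exists e', n'; split=> // [y|]; first by rewrite n'E n2E // (valP y).
have cn2 : #|porbits n2| = #|porbits n|.+2.
  rewrite porbits_tperm_split ?porbit_step //.
    by rewrite porbits_tperm_split ?porbit_step // eq_sym (pm_degree1 pm).
  by rewrite n1ex eq_sym (pm_degree1 pm).
have cod w : w \notin codom (val : D' -> D) -> w = x \/ w = e x.
  move=> wD; apply/set2P; apply: contraR wD => wS.
  by apply/codomP; exists (Sub w wS); rewrite SubK.
have cn' := @card_porbits_sub _ _ (val : D' -> D) n2 n' val_inj.
have {}cn' : #|porbits n2| + #|{: D'}| = #|porbits n'| + #|D|.
  by apply: cn' => [y|w /cod[]->]; rewrite ?n'E.
have merge : porbit f x <> porbit f (n x).
  move=> /(pm_corner pm) H; have := pm_degree1 pm x.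
  by rewrite -H ?eqxx // porbit_step.
pose F1 := (f * t1)%g; pose F := (F1 * t2)%g.
have FE w : F w = n2 (e w) by rewrite !permM.
have cF : #|porbits F| = #|porbits f|.
  rewrite -(porbits_tperm_merge merge); apply: porbits_tperm_split.
    by rewrite n1ex eq_sym (pm_degree1 pm).
  have F1x : n1 (e x) = F1 x by rewrite !permM.
  have F1ex : F1 (e x) = x by rewrite !permM eK tpermR.
  by rewrite F1x porbit_step -(porbit_step F1 (e x)) F1ex.
(* The 2-cycle of [F] on [x] and [e x] is broken into fixed points, so that [card_porbits_sub] can
   discard them. Altogether one face and one edge are lost. *)
pose F' := (tperm x (e x) * F)%g.
have F'E : F' = (F * tperm x (e x))%g.
  have Fx : F x = e x by rewrite FE n2ex.
  have Fex : F (e x) = x by rewrite FE eK n2x.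
  have tE : tperm x (e x) = (tperm x (e x) ^ F)%g by rewrite tpermJ Fx Fex tpermC.
  by rewrite [in RHS]tE /conjg mulKVg.
have cF' : #|porbits F'| = #|porbits f|.+1.
  rewrite F'E porbits_tperm_split ?cF 1?eq_sym //.
  by rewrite -(porbit_step F x) FE n2ex.
have cf' := @card_porbits_sub _ _ (val : D' -> D) F' (e' * n')%g val_inj.
have {}cf' : #|porbits F'| + #|{: D'}| = #|porbits (e' * n')%g| + #|D|.
  apply: cf' => [y|w /cod[]->].
  - have /andP[yx yex] := kept_dart y.
    by rewrite [LHS]permM tpermD 1?eq_sym // FE -e'E -n'E -permM.
  - by rewrite permM tpermL FE eK n2x.
  by rewrite permM tpermR FE n2ex.
have cD : #|D| = #|{: D'}|.+2.
  rewrite card_sig -(cardC (mem [set x; e x])) cards2 eq_sym ex addnC addn2.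
  by congr _.+2; apply: eq_card => w; rewrite !inE.
have := pm_euler pm; move: cn' cf'; rewrite cn2 cF' cD /=; lia.
Qed.

Variables (G : sgraph) (nu : D -> G).
Hypothesis rG : realizes e n nu.
Hypothesis G'3 : three_connected (del_edge (nu x) (nu (e x))).

Lemma deletion_realizes (e' n' : {perm D'}) :
  (forall y, val (e' y) = e (val y)) -> (forall y, val (n' y) = g (n (val y))) ->
  realizes (G := del_edge (nu x) (nu (e x))) e' n' (nu \o val).
Proof.
move=> e'E n'E; have nug w : nu (g w) = nu w.
  by apply/(rz_vertex rG)/porbit_skip.
split=> [y z|u|u v].
- by split=> [/(rz_vertex rG)/(porbit_deleted n'E)|/(porbit_deleted n'E)/(rz_vertex rG)].
- have [w <-] := rz_surj rG u; exists (Sub (g w) (skip_kept w)).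
  by rewrite /= nug.
split=> [/andP[/(rz_adj rG)[w [<- <-]] wS]|[y [<- <-]]]; last first.
  rewrite /= e'E /del_edge_adj (pm_nu_adj rG) /=.
  have /andP[yx yex] := kept_dart y; apply/negP => /andP[/set2P[]E1 /set2P[]E2].
  - by have := pm_nu_noloop pm rG (val y); rewrite E1 E2 eqxx.
  - by case/eqP: yx; apply: (realizes_simple pm rG).
  - by case/eqP: yex; apply: (realizes_simple pm rG); rewrite ?(pm_inv pm).
  - by have := pm_nu_noloop pm rG (val y); rewrite E1 E2 eqxx.
have wD : w \notin [set x; e x].
  by apply: contra wS => /set2P[]->; rewrite ?(pm_inv pm) !inE !eqxx ?orbT.
by exists (Sub w wD); rewrite /= e'E.
Qed.

Lemma deletion_polyhedral : exists e' n' : {perm D'},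
  [/\ forall y, val (e' y) = e (val y), forall y, val (n' y) = g (n (val y)),
      polyhedral_map e' n'
    & realizes (G := del_edge (nu x) (nu (e x))) e' n' (nu \o val)].
Proof.
have [e' [n' [e'E n'E euler]]] := deletion_map.
have rG' := deletion_realizes e'E n'E.
exists e', n'; split=> //; apply: polyhedral_of_three_connected rG' G'3 _ euler.
  by move=> y; apply: val_inj; rewrite !e'E (pm_inv pm).
move=> y z /= yz; rewrite !e'E => eyz; apply: val_inj.
exact: (realizes_simple pm rG yz).
Qed.

End Deletion.

(** * Duality *)

Lemma inj_surj_bij (S T : finType) (h : S -> T) :
  injective h -> (forall y, exists x, h x = y) -> bijective h.
Proof.
move=> hi hs; apply: inj_card_bij => //; rewrite -(card_codom hi).
by apply: subset_leq_card; apply/subsetP=> y _; have [x <-] := hs y; apply: codom_f.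
Qed.

Lemma giso_sym (G H : sgraph) : giso G H -> giso H G.
Proof.
case=> h [k hk kh] hm; exists k; first by exists h.
by move=> u v; rewrite -hm !kh.
Qed.

Lemma realizing_graph (D : finType) (e n : {perm D}) :
  polyhedral_map e n -> exists (G : sgraph) (nu : D -> G), realizes e n nu.
Proof.
move=> pm.
pose V : finType := {A : {set D} | A \in porbits n}.
pose a (A B : V) := [exists x in val A, e x \in val B].
have a_sym : symmetric a.
  by move=> A B; apply/exists_inP/exists_inP => -[x xA xB]; exists (e x);
    rewrite ?(pm_inv pm).
have a_irr : irreflexive a.
  case=> A Ap; apply/exists_inP => -[x /= xA exA]; apply: (pm_noloop pm (x := x)).
  by case/imsetP: Ap xA exA => y _ -> /eq_porbit_in-> /eq_porbit_in->.
have mem_nu x : porbit n x \in porbits n by apply: imset_f.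
pose nu x : V := exist _ (porbit n x) (mem_nu x).
have in_nu x (A : V) : x \in val A -> nu x = A.
  move=> xA; apply: val_inj; move: xA => /=.
  by case/imsetP: (valP A) => y _ -> /eq_porbit_in.
exists (SGraph a_sym a_irr), nu; split=> [x y|A|A B].
- split=> [/(congr1 val)//|E]; exact: val_inj.
- have /imsetP[x _ xA] := valP A; exists x; apply: val_inj; exact/esym.
split=> [/exists_inP[x /in_nu xA /in_nu xB]|[x [<- <-]]]; first by exists x.
by apply/exists_inP; exists x; rewrite /= porbit_id.
Qed.

Section PolyhedronOfMap.
Variables (D : finType) (e n : {perm D}) (G : sgraph) (nu : D -> G).
Hypotheses (pm : polyhedral_map e n) (rG : realizes e n nu).

Lemma polyhedral_sphere_embedding :
  exists s : {perm dart G}, exists phi : D -> dart G,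
    [/\ bijective phi, forall x, phi (e x) = drev (phi x),
        forall x, phi (n x) = s (phi x), forall x, src (phi x) = nu x
      & sphere_embedding s].
Proof.
apply: sphere_embedding_exists rG (realizes_simple pm rG) (pm_inv pm) (pm_euler pm).
by case: (three_connected_of_polyhedral pm rG) => _ c; apply: c; rewrite cards0.
Qed.

Lemma polyhedral_planar : exists s : {perm dart G}, sphere_embedding s.
Proof. by have [s [phi []]] := polyhedral_sphere_embedding; exists s. Qed.

Lemma dual_realized (H : sgraph) (mu : D -> H) :
  realizes e (e * n)%g mu ->
  exists2 s : {perm dart G}, sphere_embedding s & giso (dual s) H.
Proof.
move=> rH; have [s [phi [phi_bij phie phin _ sphere]]] := polyhedral_sphere_embedding.
have phi_inj := bij_inj phi_bij.
exists s => //; apply: giso_sym.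
have facesE x : phi @: [set y | mu y == mu x] = porbit (drev_perm G * s)%g (phi x).
  rewrite (porbit_image (s' := (e * n)%g)) => [|y]; last first.
    by rewrite !permM permE -phie phin.
  suff -> : [set y | mu y == mu x] = porbit (e * n)%g x by [].
  apply/setP=> y; rewrite inE; apply/eqP/idP.
    by move/(rz_vertex rH)/eq_porbit_in.
  by move/eq_porbit_in/(rz_vertex rH).
have face_proof u : phi @: [set y | mu y == u] \in faces s.
  by have [x <-] := rz_surj rH u; rewrite facesE; apply: imset_f.
pose h u : dual s := exist _ (phi @: [set y | mu y == u]) (face_proof u).
have h_inj : injective h.
  move=> u v /(congr1 val) /= E; have /setP uv := imset_inj phi_inj E.
  by have [x xu] := rz_surj rH u; have := uv x; rewrite !inE xu eqxx => /esym/eqP.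
exists h.
  apply: inj_surj_bij => // -[F Fs]; have /imsetP[d _ FE] := Fs.
  have [psi _ psiK] := phi_bij.
  by exists (mu (psi d)); apply: val_inj; rewrite /= facesE psiK FE.
move=> u v; rewrite /= /dual_adj (inj_eq h_inj).
apply/andP/idP => [[_ /exists_inP[_ /imsetP[x xu ->]]]|uv].
  rewrite -phie => /imsetP[y yv /phi_inj E]; apply/(rz_adj rH); exists x.
  by move: xu yv; rewrite -E !inE => /eqP-> /eqP->.
split; first by apply: contraTneq uv => ->; rewrite adj_irr.
have /(rz_adj rH)[x [xu xv]] := uv.
apply/exists_inP; exists (phi x); rewrite -?phie /= imset_f // inE ?xu ?xv //.
Qed.

End PolyhedronOfMap.

(** * Contracting an edge *)

Lemma orbit_traject (T : finType) (h : T -> T) x k :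
  uniq (traject h x k.+1) -> iter k.+1 h x = x -> orbit h x = traject h x k.+1.
Proof.
move=> ut hk.
have cyc : fcycle h (traject h x k.+1).
  have -> : traject h x k.+1 = x :: traject h (h x) k by [].
  rewrite /= -[X in rcons _ X]hk iterSr -trajectSr fpath_traject //.
by rewrite (orbitE cyc ut) ?index_head ?rot0 // !inE eqxx.
Qed.

Lemma map_traject_hom (S T : Type) (h : S -> S) (k : T -> T) (i : S -> T) x m :
  (forall y, i (h y) = k (i y)) -> map i (traject h x m) = traject k (i x) m.
Proof. by move=> ih; elim: m x => //= m IHm x; rewrite IHm ih. Qed.

Lemma iter_hom (S T : Type) (h : S -> S) (k : T -> T) (i : S -> T) x m :
  (forall y, i (h y) = k (i y)) -> i (iter m h x) = iter m k (i x).
Proof. by move=> ih; elim: m => //= m IHm; rewrite ih IHm. Qed.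

Section Contract.
Variables (G : sgraph) (p q : G).

(** The merged vertex keeps the name [p]; the condition [u != v] discards the loop left by the
    contracted edge. *)
Definition contract_adj (u v : {v : G | v != q}) : bool :=
  (u != v) && [|| adj (val u) (val v), (val u == p) && adj q (val v)
                | (val v == p) && adj q (val u)].

Fact contract_sym : symmetric contract_adj.
Proof.
move=> u v; rewrite /contract_adj eq_sym adj_sym; congr (_ && (_ || _)).
exact: orbC.
Qed.

Fact contract_irr : irreflexive contract_adj.
Proof. by move=> u; rewrite /contract_adj eqxx. Qed.

Definition contract : sgraph := SGraph contract_sym contract_irr.

End Contract.

Section Contraction.
Variables (D : finType) (e n : {perm D}) (G : sgraph) (nu : D -> G).
Hypotheses (pm : polyhedral_map e n) (rG : realizes e n nu).
Variable x : D.
Local Notation f := (e * n)%g.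
Local Notation D' := {y : D | y \notin [set x; e x]}.
Local Notation p := (nu x).
Local Notation q := (nu (e x)).
Variables e' m' : {perm D'}.
Hypotheses (e'E : forall y, val (e' y) = e (val y))
  (m'E : forall y, val (m' y) = skip e f x (f (val y)))
  (pm' : polyhedral_map e' m').
Local Notation N := (e' * m')%g.
Let K := contract p q.
Let lift w (wS : w \notin [set x; e x]) : D' := exist _ w wS.

(** Deletion in the dual joins the rotations at the two ends: where the cycle at [p] would reach
    [x], it goes on behind [e x], and conversely. *)
Lemma contraction_step y : val (N y) =
  if n (val y) == x then n (e x) else
  if n (val y) == e x then n x else n (val y).
Proof.
by rewrite permM m'E e'E /skip !permM !(pm_inv pm).
Qed.

Lemma nu_qp : p != q. Proof. by rewrite eq_sym (pm_nu_noloop pm rG). Qed.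

Let p' : K := exist _ p nu_qp.
Let kappa w := if nu w == q then p else nu w.
(** The default [p'] is never taken, by [kappa_neq]. *)
Let nuK (y : D') : K := insubd p' (kappa (val y)).

Lemma kappa_neq w : kappa w != q.
Proof. by rewrite /kappa; have [_|//] := eqVneq (nu w) q; apply: nu_qp. Qed.

Lemma val_nuK y : val (nuK y) = kappa (val y).
Proof. by rewrite val_insubd kappa_neq. Qed.

Lemma kappa_step w : kappa (n w) = kappa w.
Proof. by rewrite /kappa (pm_nu_next rG). Qed.

Lemma kappa_id w : nu w != q -> kappa w = nu w.
Proof. by rewrite /kappa => /negPf->. Qed.

Lemma kappa_q w : nu w = q -> kappa w = p.
Proof. by rewrite /kappa => ->; rewrite eqxx. Qed.

Lemma kappa_N y : nuK (N y) = nuK y.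
Proof.
apply: val_inj; rewrite !val_nuK contraction_step -(kappa_step (val y)).
have kx : kappa x = p by rewrite kappa_id // nu_qp.
have kex : kappa (e x) = p by rewrite kappa_q.
have [->|_] := eqVneq (n (val y)) x; first by rewrite kappa_step kx kex.
by have [->|//] := eqVneq (n (val y)) (e x); rewrite kappa_step kx kex.
Qed.

(** From [z] on, [N] follows [n] until a removed dart is met. The two hypotheses place [z] directly
    behind that dart, so the walk is then already complete. *)
Lemma contraction_orbit (z : D') :
  (nu (val z) = p -> val z = n x) -> (nu (val z) = q -> val z = n (e x)) ->
  forall y, nu (val y) = nu (val z) -> porbit N y = porbit N z.
Proof.
move=> zp zq y yz.
pose A := [pred w | (nu w == nu (val z)) &&
  [forall y' : D', (val y' == w) ==> (porbit N y' == porbit N z)]].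
suff : val y \in A.
  by rewrite inE => /andP[_ /forallP/(_ y)]; rewrite eqxx => /eqP.
apply: (porbit_closed (s := n) (x := val z)) => [w||]; last 2 first.
- rewrite inE eqxx; apply/forallP=> y'; apply/implyP=> /eqP/val_inj->.
  by rewrite eqxx.
- by apply/eq_porbit_in/(rz_vertex rG).
rewrite !inE (pm_nu_next rG) => /andP[/eqP wz /forallP Aw].
rewrite wz eqxx; apply/forallP=> y'; apply/implyP=> /eqP y'w.
have [wS|wS] := boolP (w \in [set x; e x]).
  suff -> : y' = z by rewrite eqxx.
  apply: val_inj; rewrite y'w.
  by case/set2P: wS wz => -> /esym; [move/zp=> -> | move/zq=> ->].
have := Aw (lift wS); rewrite /= eqxx => /eqP <-.
rewrite -(porbit_step N (lift wS)).
suff -> : y' = N (lift wS) by rewrite eqxx.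
apply: val_inj; rewrite contraction_step /= -y'w.
by have /andP[/negPf-> /negPf->] := kept_dart y'.
Qed.

Let nx_kept : n x \notin [set x; e x].
Proof. by rewrite mem_kept (pm_degree1 pm) (pm_noloop_step pm). Qed.

Let nex_kept : n (e x) \notin [set x; e x].
Proof.
by rewrite mem_kept (pm_degree1 pm) andbT -{2}[x](pm_inv pm) (pm_noloop_step pm).
Qed.

Let zp : D' := exist _ (n x) nx_kept.
Let zq : D' := exist _ (n (e x)) nex_kept.

Lemma orbit_zp y : nu (val y) = p -> porbit N y = porbit N zp.
Proof.
move=> yp; apply: contraction_orbit => //; rewrite /= (pm_nu_next rG) //.
by move/eqP; rewrite (negPf nu_qp).
Qed.

Lemma orbit_zq y : nu (val y) = q -> porbit N y = porbit N zq.
Proof.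
move=> yq; apply: contraction_orbit => //; rewrite /= (pm_nu_next rG) //.
by move/esym/eqP; rewrite (negPf nu_qp).
Qed.

Lemma orbit_zpq : porbit N zp = porbit N zq.
Proof.
have kept : n^-1%g x \notin [set x; e x].
  rewrite mem_kept; apply/andP; split; apply/eqP=> E.
    by have := pm_degree1 pm x; rewrite -{1}E permKV eqxx.
  by have := pm_noloop_step pm (e x); rewrite (pm_inv pm) -E permKV eqxx.
rewrite -(orbit_zp (y := lift kept)) /=; last first.
  by rewrite -(pm_nu_next rG) permKV.
rewrite -porbit_step; congr (porbit _ _); apply: val_inj.
by rewrite contraction_step /= permKV eqxx.
Qed.

Lemma contraction_realizes : realizes (G := K) e' N nuK.
Proof.
split=> [y z|u|u v].
- split=> [/(congr1 val)|]; last exact: porbit_invariant kappa_N.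
  rewrite !val_nuK /kappa.
  have [yq|yq] := eqVneq (nu (val y)) q; have [zq'|zq'] := eqVneq (nu (val z)) q.
  + by rewrite !orbit_zq.
  + by move=> /esym zp'; rewrite orbit_zq // -orbit_zpq orbit_zp.
  + by move=> yp'; rewrite [RHS]orbit_zq // -orbit_zpq orbit_zp.
  move=> yz; have [yp|yp] := eqVneq (nu (val y)) p.
    by rewrite !orbit_zp // -yz.
  apply: contraction_orbit; rewrite -?yz // => E.
    by rewrite E eqxx in yp.
  by rewrite E eqxx in yq.
- have [w wu] := rz_surj rG (val u).
  have uq := valP u; rewrite /= in uq.
  have [wx|wx] := eqVneq w x.
    exists zp; apply: val_inj; rewrite wx in wu.
    by rewrite val_nuK /= kappa_step kappa_id wu.
  have wS : w \notin [set x; e x].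
    by rewrite mem_kept wx; apply: contraNneq uq => E; rewrite -wu E.
  exists (lift wS); apply: val_inj.
  by rewrite val_nuK /= kappa_id wu.
have adj_of w : w \notin [set x; e x] -> kappa w = val u -> kappa (e w) = val v ->
    exists y, nuK y = u /\ nuK (e' y) = v.
  move=> wS wu wv; exists (lift wS).
  by split; apply: val_inj; rewrite val_nuK ?e'E.
have uq := valP u; have vq := valP v; rewrite /= in uq vq.
split=> [/andP[uv /or3P[]]|[y [yu yv]]].
- case/(rz_adj rG)=> w [wu wv]; apply: (adj_of w); rewrite ?kappa_id ?wu ?wv //.
  rewrite mem_kept; apply/andP; split.
    by apply: contraNneq vq => E; rewrite -wv E.
  by apply: contraNneq uq => E; rewrite -wu E.
- case/andP=> /eqP up /(rz_adj rG)[w [wq wv]].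
  have wS : w \notin [set x; e x].
    rewrite mem_kept; apply/andP; split; apply/eqP=> E.
      by have := nu_qp; rewrite -wq E eqxx.
    by move/eqP: uv; apply; apply: val_inj; rewrite up -wv E (pm_inv pm).
  apply: (adj_of w) => //; first by rewrite kappa_q.
  by rewrite kappa_id wv.
- case/andP=> /eqP vp /(rz_adj rG)[w [wq wu]].
  have wS : w \notin [set x; e x].
    rewrite mem_kept; apply/andP; split; apply/eqP=> E.
      by have := nu_qp; rewrite -wq E eqxx.
    by move/eqP: uv; apply; apply: val_inj; rewrite vp -wu E (pm_inv pm).
  apply: (adj_of (e w)); first exact: (kept_inv pm).
    by rewrite kappa_id wu.
  by rewrite (pm_inv pm) kappa_q.
have kyu : kappa (val y) = val u by rewrite -yu val_nuK.
have kyv : kappa (e (val y)) = val v by rewrite -yv val_nuK e'E.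
have /andP[yx yex] := kept_dart y.
have ay := pm_nu_adj rG (val y).
rewrite /= /contract_adj; have -> /= : u != v.
  apply/eqP=> uv; move: kyv; rewrite -uv -kyu /kappa.
  have [yq|yq] := eqVneq (nu (val y)) q; have [eyq|eyq] := eqVneq (nu (e (val y))) q.
  + by move: ay; rewrite yq eyq adj_irr.
  + move=> E; case/eqP: yex; apply: (realizes_simple pm rG) => //.
    by rewrite (pm_inv pm).
  + by move=> E; case/eqP: yx; apply: (realizes_simple pm rG).
  by move=> E; move: ay; rewrite E adj_irr.
move: kyu kyv; rewrite /kappa.
have [yq|yq] := eqVneq (nu (val y)) q; have [eyq|eyq] := eqVneq (nu (e (val y))) q.
- by move: ay; rewrite yq eyq adj_irr.
- by move=> <- <-; move: ay; rewrite yq eqxx => ->; rewrite orbT.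
- by move=> <- <-; move: ay; rewrite eyq eqxx adj_sym => ->; rewrite !orbT.
by move=> <- <-; move: ay => ->.
Qed.

Lemma contraction_polyhedral : polyhedral_map e' N.
Proof. exact: polyhedral_map_dual. Qed.

Lemma degree_ge3 w : 2 < #|porbit n w|.
Proof.
have us : uniq [:: w; n w; n (n w)].
  rewrite /= !inE negb_or eq_sym (pm_degree1 pm) eq_sym (pm_degree pm) /=.
  by rewrite eq_sym (pm_degree1 pm).
rewrite (leq_trans _ (subset_leq_card (A := [in [:: w; n w; n (n w)]]) _)) //.
  by rewrite (card_uniqP us).
apply/subsetP=> y; rewrite !inE => /or3P[]/eqP->; apply/eq_porbit_in;
by rewrite ?porbit_step.
Qed.

(* The contraction's rotation at the merged vertex runs through the darts of
   p from n x, then through those of q from n (e x). *)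
Lemma contraction_iter (z : D') w k : val z = n w ->
  w = x \/ w = e x -> k.+1 < #|porbit n w| ->
  val (iter k N z) = iter k.+1 n w.
Proof.
move=> zw wx; elim: k => [//|k IHk] kw /=.
rewrite contraction_step IHk ?(ltnW kw) //.
rewrite -[n (iter _ _ _)]/(iter k.+2 n w); set t := iter k.+2 n w.
have tw : t != w.
  have := uniq_traject_porbit n w; set m := #|_| in kw *; move=> um.
  have m_gt0 : 0 < m by apply: leq_ltn_trans kw.
  have := @nth_uniq _ w (traject n w m) k.+2 0; rewrite size_traject.
  by rewrite !nth_traject // => /(_ kw m_gt0 um) /negbT.
have ntw : nu t = nu w.
  by rewrite /t; elim: (k.+2) => //= j IHj; rewrite (pm_nu_next rG).
case: wx => E; rewrite E in tw ntw; first rewrite (negPf tw).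
  by rewrite ifN //; apply/eqP => tE; have := nu_qp; rewrite -ntw tE eqxx.
rewrite (negPf tw) ifN //; apply/eqP => tE.
by have := nu_qp; rewrite -ntw tE eqxx.
Qed.

Lemma contraction_turn (z z' : D') w : val z = n w -> val z' = n (e w) ->
  w = x \/ w = e x -> iter #|porbit n w|.-1 N z = z'.
Proof.
move=> zw z'w wx; have := degree_ge3 w; case E: #|porbit n w| => [|[|m]] // _.
apply: val_inj; rewrite /= contraction_step (contraction_iter zw wx) ?E //.
have -> : n (iter m.+1 n w) = w by rewrite -[LHS]/(iter m.+2 n w) -E iter_porbit.
rewrite z'w; case: wx => ->; first by rewrite eqxx.
by rewrite eqxx (negPf (pm_fix pm x)) (pm_inv pm).
Qed.

(** The arc contributed to the merged rotation by one end of the contracted edge; it is one shorter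
    than the orbit because [w] itself is gone. *)
Let tour (z : D') w := traject N z #|porbit n w|.-1.

Lemma val_tour (z : D') w : val z = n w -> w = x \/ w = e x ->
  map val (tour z w) = traject n (n w) #|porbit n w|.-1.
Proof.
move=> zw wx; apply: (@eq_from_nth _ (n w)); rewrite ?size_map !size_traject // => i im.
rewrite (nth_map z) ?size_traject // !nth_traject // (contraction_iter zw wx).
  by rewrite iterSr.
by move: im; case: #|_|.
Qed.

Lemma porbit_tour w : w = x \/ w = e x ->
  traject n w #|porbit n w| = w :: traject n (n w) #|porbit n w|.-1.
Proof. by have := degree_ge3 w; case: #|_|. Qed.

Lemma tour_uniq (z : D') w : val z = n w -> w = x \/ w = e x -> uniq (tour z w).
Proof.
move=> zw wx; rewrite -(map_inj_uniq val_inj) val_tour //.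
by have := uniq_traject_porbit n w; rewrite porbit_tour //= => /andP[].
Qed.

Lemma mem_tour (z : D') w y : val z = n w -> w = x \/ w = e x ->
  (y \in tour z w) = (nu (val y) == nu w).
Proof.
move=> zw wx; rewrite -(mem_map val_inj) val_tour //.
have -> : (nu (val y) == nu w) = (val y \in porbit n w).
  by apply/eqP/idP => [/(rz_vertex rG)/eq_porbit_in|/eq_porbit_in/(rz_vertex rG)].
rewrite porbit_traject porbit_tour // inE; apply/esym/orb_idl => /eqP yw.
by have := kept_dart y; case: wx yw => -> ->; rewrite eqxx ?andbF.
Qed.

Lemma contraction_simple y z :
  nuK y = nuK z -> nuK (e' y) = nuK (e' z) -> y = z.
Proof. exact: (realizes_simple contraction_polyhedral contraction_realizes). Qed.

(** A common neighbour would produce parallel edges in the contraction, which is a polyhedral map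
    and hence simple. *)
Lemma no_common_neighbour v : adj p v -> adj q v -> False.
Proof.
case/(rz_adj rG)=> w [wp wv] /(rz_adj rG)[w' [w'q w'v]].
have vq : v != q by rewrite -w'v -w'q (pm_nu_noloop pm rG).
have vp : v != p by rewrite -wv -wp (pm_nu_noloop pm rG).
have wS : w \notin [set x; e x].
  rewrite mem_kept; apply/andP; split; apply/eqP=> E.
    by rewrite -wv E eqxx in vq.
  by have := nu_qp; rewrite -wp E eqxx.
have w'S : w' \notin [set x; e x].
  rewrite mem_kept; apply/andP; split; apply/eqP=> E.
    by have := nu_qp; rewrite -w'q E eqxx.
  by rewrite -w'v E (pm_inv pm) eqxx in vp.
have E : lift wS = lift w'S.
  apply: contraction_simple; apply: val_inj; rewrite !val_nuK ?e'E /=.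
    by rewrite kappa_id ?wp ?nu_qp // kappa_q.
  by rewrite /kappa wv w'v.
by have := nu_qp; rewrite -wp -w'q; case: E => ->; rewrite eqxx.
Qed.

(** Since [p] and [q] have no common neighbour, the edges moved back to the new vertex are exactly
    those that came from [q]. *)
Lemma expansion_giso (b : seq K) :
  (forall w : K, (w \in b) = adj q (val w) && (w != p')) ->
  giso (expand p' b) G.
Proof.
move=> bE; pose h (u : option K) := if u is Some v then val v else q.
exists h.
  exists (fun v => insub v).
    by case=> [v|] /=; rewrite ?valK // insubF // eqxx.
  move=> v /=; case: insubP => [u _ <- //|]; by rewrite negbK => /eqP->.
have Kadj (u : K) : (u == p') || (u \in b) = adj q (val u).
  rewrite bE; have [->|//] := eqVneq u p'; last by rewrite andbT.
  by rewrite /= adj_sym (pm_nu_adj rG).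
case=> [u|] [v|] /=; rewrite ?Kadj ?adj_irr //; last by rewrite adj_sym.
rewrite !bE /contract_adj.
apply/idP/idP => [uv|/and3P[/andP[uv /or3P[//||]]]].
- rewrite uv /= andbT; apply/and3P; split.
  + by apply: contraTneq uv => ->; rewrite adj_irr.
  + apply/negP => /andP[/eqP up /andP[qv _]].
    by apply: no_common_neighbour qv; move: uv; rewrite up.
  apply/negP => /andP[/eqP vp /andP[qu _]].
  by apply: no_common_neighbour qu; move: uv; rewrite vp adj_sym.
- case/andP=> /eqP up qv /negP[].
  have -> : u = p' by apply: val_inj.
  rewrite eqxx /=; apply/andP; split; first exact: qv.
  by apply: contraNneq uv => ->; apply/eqP/val_inj.
case/andP=> /eqP vp qu _ /negP[].
have -> : v = p' by apply: val_inj.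
rewrite eqxx /=; apply/andP; split; first exact: qu.
by apply: contraNneq uv => ->; apply/eqP/val_inj/esym.
Qed.

Lemma contraction_expansion : exists KP : polyhedron,
  (exists nu' : D' -> KP, realizes e' N nu') /\
  forall GP : polyhedron, giso G GP -> vertex_expansion KP GP.
Proof.
have rK := contraction_realizes; have pK := contraction_polyhedral.
have [s [phi [phi_bij phie phiN phisrc sphere]]] := polyhedral_sphere_embedding pK rK.
exists (Polyhedron (three_connected_of_polyhedral pK rK) (polyhedral_planar pK rK)).
split=> [|GP [k kbij kmono]]; first by exists nuK.
exists s; split=> //; exists (phi zp).
have xx : x = x \/ x = e x by left.
have exx : e x = x \/ e x = e x by right.
pose dstK y := nuK (e' y).
have dstE y : dst (phi y) = dstK y by rewrite /dstK -phisrc phie.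
have phiNn m y : map phi (traject N y m) = traject s (phi y) m.
  exact: map_traject_hom.
have szx := degree_ge3 x; have szex := degree_ge3 (e x).
(* The two arcs have degree minus one entries each, hence at least 2. *)
exists (map dstK (tour zp x)), (map dstK (tour zq (e x))).
split; rewrite ?size_map ?size_traject; try by move: szx szex; case: #|_| => //= m; case: #|_|.
  have orbE : orbit s (phi zp) = map phi (tour zp x ++ tour zq (e x)).
    have zpE : val zp = n x by []. have zqE : val zq = n (e x) by [].
    have zpE' : val zp = n (e (e x)) by rewrite (pm_inv pm).
    have turn := contraction_turn zpE zqE xx.
    have turn' := contraction_turn zqE zpE' exx.
    have us : uniq (tour zp x ++ tour zq (e x)).
      rewrite cat_uniq !tour_uniq //= andbT; apply/hasPn => y.
      by rewrite !mem_tour // => /eqP->; rewrite eq_sym nu_qp.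
    move: us; rewrite -(map_inj_uniq (bij_inj phi_bij)) /tour -turn.
    rewrite -trajectD !phiNn; set j := _ + _ => us.
    have jK : iter j s (phi zp) = phi zp.
      by rewrite -(iter_hom zp j phiN) /j addnC iterD turn turn'.
    have : 0 < j by rewrite /j addn_gt0; move: szx; case: #|_| => [|[]].
    by case: j us jK => // j us jK _; apply: orbit_traject.
  rewrite orbE -map_comp map_cat.
  by congr (_ ++ _); apply: eq_map.
have [h hbij hmono] : giso (expand p' (map dstK (tour zq (e x)))) G.
  apply: expansion_giso => w; apply/mapP/andP => [[y]|[qw wp]].
    rewrite mem_tour // => /eqP yq ->; rewrite /dstK val_nuK e'E.
    have ay := pm_nu_adj rG (val y).
    rewrite kappa_id; last by rewrite -yq (pm_nu_noloop pm rG).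
    split; first by rewrite -yq.
    apply/eqP => /(congr1 val); rewrite val_nuK e'E /= => E.
    have /andP[_ /eqP[]] := kept_dart y.
    apply: (realizes_simple pm rG) => //; rewrite (pm_inv pm) -E kappa_id //.
    by rewrite -yq (pm_nu_noloop pm rG).
  have /(rz_adj rG)[t [tq tw]] := qw.
  have tS : t \notin [set x; e x].
    rewrite mem_kept; apply/andP; split; apply/eqP=> E.
      by have := nu_qp; rewrite -tq E eqxx.
    by case/eqP: wp; apply: val_inj; rewrite /= -tw E (pm_inv pm).
  exists (lift tS); first by rewrite mem_tour //= tq.
  by apply: val_inj; rewrite /dstK val_nuK e'E /= kappa_id tw // (valP w).
have -> : src (phi zp) = p' :> K.
  rewrite phisrc; apply: val_inj; rewrite val_nuK kappa_id /= (pm_nu_next rG) //.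
  exact: nu_qp.
exists (k \o h); first exact: bij_comp.
by move=> u v /=; rewrite kmono hmono.
Qed.

End Contraction.

(** * Deletion in a triangle *)

Definition nbrs (G : sgraph) (u : G) : {set G} := [set v | adj u v].

Lemma three_connected_or_cut (G : sgraph) : 3 < #|G| ->
  three_connected G \/ exists (S : {set G}) (l : G -> bool) (a b : G),
    [/\ #|S| < 3,
        forall u v, u \notin S -> v \notin S -> adj u v -> l u = l v,
        a \notin S /\ b \notin S, l a & ~~ l b].
Proof.
move=> G3; pose r (S : {set G}) := [rel u v : G | [&& adj u v, u \notin S & v \notin S]].
pose cut (S : {set G}) a b := [&& #|S| < 3, a \notin S, b \notin S & ~~ connect (r S) a b].
have [/existsP[S /existsP[a /existsP[b /and4P[S3 aS bS ab]]]]|nocut] :=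
  boolP [exists S, exists a, exists b, cut S a b].
  right; exists S, (connect (r S) a), a, b; split=> // u v uS vS uv.
  apply/idP/idP => au; apply: connect_trans au (connect1 _); rewrite /= uS vS ?uv //.
  by rewrite adj_sym uv.
left; split=> // S S3 a b aS bS; apply/negPn/negP => ab.
case/negP: nocut; apply/existsP; exists S; apply/existsP; exists a.
by apply/existsP; exists b; apply/and4P.
Qed.

(** Otherwise [s] and [t] would separate [X] from [z]. *)
Lemma no_two_cut (G : sgraph) (X : pred G) (s t z : G) :
  three_connected G ->
  (forall u w, X u -> adj u w -> [|| X w, w == s | w == t]) ->
  ~~ X s -> ~~ X t -> ~~ X z -> z != s -> z != t -> forall u, ~~ X u.
Proof.
move=> G3 clX Xs Xt Xz zs zt u; apply/negP => Xu.
have S3 : #|[set s; t]| < 3 by rewrite cards2; case: (_ != _).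
have := @three_connected_label G [set s; t] X G3 S3 _ u z.
rewrite Xu (negPf Xz) => H; suff : true = false by [].
apply: H; last 2 first.
- by rewrite !inE negb_or; apply/andP; split; apply: contraTneq Xu => ->.
- by rewrite !inE negb_or zs zt.
have half a b : b \notin [set s; t] -> adj a b -> X a -> X b.
  rewrite !inE negb_or => /andP[/negPf bs /negPf bt] ab Xa.
  by have := clX a b Xa ab; rewrite bs bt !orbF.
move=> a b aS bS ab; apply/idP/idP; apply: half => //.
by rewrite adj_sym.
Qed.

(** A cut of the smaller graph is no cut of [G], so the edge [a b] itself must cross it; the label
    is complemented if that is needed to put [a] on the true side. *)
Lemma del_edge_cut (G : sgraph) (a b : G) : three_connected G -> adj a b ->
  three_connected (del_edge a b) \/ exists (S : {set G}) (l : G -> bool),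
    [/\ #|S| < 3, a \notin S /\ b \notin S, l a, ~~ l b &
        forall u w, u \notin S -> w \notin S -> adj u w -> l u -> ~~ l w ->
          u = a /\ w = b].
Proof.
move=> G3 ab.
have [] : three_connected (del_edge a b) \/
    exists (S : {set G}) (l : G -> bool) (x y : G), [/\ #|S| < 3,
      forall u v : G, u \notin S -> v \notin S -> del_edge_adj a b u v -> l u = l v,
      x \notin S /\ y \notin S, l x & ~~ l y].
- exact: (@three_connected_or_cut (del_edge a b) (proj1 G3)).
- by left.
case=> S [l [x [y [S3 lS [xS yS] lx ly]]]].
have cross u w : u \notin S -> w \notin S -> adj u w -> l u != l w ->
    (u = a /\ w = b) \/ (u = b /\ w = a).
  move=> uS wS uw luw; have : ~~ del_edge_adj a b u w.
    by apply: contra luw => /(lS u w uS wS) ->.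
  rewrite /del_edge_adj uw negbK => /andP[/set2P uab /set2P wab].
  by case: uab luw uw => -> luw uw; case: wab luw uw => ->;
    rewrite ?adj_irr //; auto.
right; have [|nocross] := boolP [exists u, exists w,
    [&& u \notin S, w \notin S, adj u w & l u != l w]].
  case/existsP=> u /existsP[w /and4P[uS wS uw luw]].
  have [aS bS lab] : [/\ a \notin S, b \notin S & l a != l b].
    by case: (cross u w uS wS uw luw) => -[<- <-]; rewrite // eq_sym.
  have [la|la] := boolP (l a).
    exists S, l; rewrite la; split=> //; first by move: lab; rewrite la; case: (l b).
    move=> u' w' u'S w'S u'w' lu' lw'.
    have [//|[u'b _]] : (u' = a /\ w' = b) \/ (u' = b /\ w' = a).
      by apply: cross; rewrite // lu' (negPf lw').
    by move: lab; rewrite la -u'b lu'.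
  exists S, (fun v => ~~ l v); rewrite la; split=> //.
    by move: lab; rewrite (negPf la); case: (l b).
  move=> u' w' u'S w'S u'w' lu' /negPn lw'.
  have [//|[u'b _]] : (u' = a /\ w' = b) \/ (u' = b /\ w' = a).
    by apply: cross; rewrite // lw' (negPf lu').
  by move: lab; rewrite (negPf la) -u'b (negPf lu').
suff E : l x = l y by rewrite -E lx in ly.
apply: (three_connected_label G3 S3) => // u w uS wS uw.
apply/eqP; apply: contraNT nocross => luw; apply/existsP; exists u.
by apply/existsP; exists w; apply/and4P.
Qed.

Lemma card_sub4 (T : finType) (A : {set T}) (x y z w : T) :
  3 < #|A| -> {subset A <= [:: x; y; z; w]} ->
  [/\ z != w, y != z, x != w, z \in A & w \in A].
Proof.
move=> A4 sub; have s4 : #|[in [:: x; y; z; w]]| <= 4 by apply: card_size.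
have sA : A \subset [in [:: x; y; z; w]] by apply/subsetP.
have AE : A =i [:: x; y; z; w].
  by apply/subset_cardP => //; apply/eqP; rewrite eqn_leq subset_leq_card // (leq_trans s4).
have : uniq [:: x; y; z; w].
  by apply/card_uniqP; rewrite -(eq_card AE); apply/eqP; rewrite eqn_leq A4 andbT (eq_card AE).
rewrite /= !inE !negb_or !AE !inE !eqxx !orbT.
by case/and4P=> /and3P[xy xz xw] /andP[yz yw] zw _; split.
Qed.

(** The path from [a] through [c] to [b] survives the deletion, so [c] belongs to the cut. *)
Lemma triangle_cut (G : sgraph) (a b c : G) :
  three_connected G -> adj a b -> adj a c -> adj b c ->
  three_connected (del_edge a b) \/ exists (v : G) (l : G -> bool),
    [/\ v != a, v != b, l a, ~~ l b &
        forall u w, u \notin [:: c; v] -> w \notin [:: c; v] -> adj u w ->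
          l u -> ~~ l w -> u = a /\ w = b].
Proof.
move=> G3 ab ac bc; have [|[S [l [S3 [aS bS] la lb cross]]]] := del_edge_cut G3 ab.
  by left.
have cS : c \in S.
  apply/negPn/negP => cS; have [lc|lc] := boolP (l c).
    have [|ca _] := cross c b cS bS _ lc lb; first by rewrite adj_sym.
    by move: ac; rewrite ca adj_irr.
  have [_ cb] := cross a c aS cS ac la lc.
  by move: bc; rewrite cb adj_irr.
have [v vab Sv] : exists2 v, (v != a) && (v != b) & {subset S <= [:: c; v]}.
  have [S0|[v vS]] := set_0Vmem (S :\ c).
    (* A cut consisting of [c] alone is listed with [v = c]. *)
    exists c; first by apply/andP; split;
      [apply: contraNneq aS => <- | apply: contraNneq bS => <-].
    move=> u uS; have := in_set0 u; rewrite -S0 !inE uS andbT => /negbFE->//.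
  have /setD1P[vc vS'] := vS; exists v.
    by apply/andP; split; [apply: contraNneq aS => <- | apply: contraNneq bS => <-].
  move=> u uS; rewrite !inE; apply/orP.
  have [uc|uc] := eqVneq u c; [by left | right].
  have : #|S :\ c| <= 1 by have := cardsD1 c S; rewrite cS add1n => E; rewrite E in S3.
  by move/card_le1_eqP => H; rewrite (H u v) // in_setD1 uc.
have [va vb] := andP vab; right; exists v, l; split=> // u w uc wc uw lu lw.
by apply: cross => //; [apply: contra uc | apply: contra wc]; apply: Sv.
Qed.

(* If neither deletion is 3-connected, uncross the two cuts {c, v} and {b, v'}:
   v and v' lie on the side of a, so two of the four quadrants are cut off by
   two vertices, hence empty, and the side of b in the first cut is {b}. *)
Lemma triangle_deletion (G : sgraph) (a b c : G) :
  three_connected G -> adj a b -> adj a c -> adj b c ->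
  3 < #|nbrs a| -> 3 < #|nbrs b| ->
  three_connected (del_edge a b) \/ three_connected (del_edge a c).
Proof.
move=> G3 ab ac bc da db.
have [|[v [l [va vb la lb cross]]]] := triangle_cut G3 ab ac bc; first by left.
have cb : adj c b by rewrite adj_sym.
have [|[v' [l' [v'a v'c la' lc' cross']]]] := triangle_cut G3 ac ab cb; first by right.
exfalso.
have nab : a != b by apply: contraTneq ab => ->; rewrite adj_irr.
have nac : a != c by apply: contraTneq ac => ->; rewrite adj_irr.
have nbc : b != c by apply: contraTneq bc => ->; rewrite adj_irr.
have notin (x y z : G) : (x \notin [:: y; z]) = (x != y) && (x != z).
  by rewrite !inE negb_or.
(* [A], [B] are the sides of [a] and [b] in the first cut; [A'], [C'] those of [a] and [c] in the
   second. *)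
pose inS u := (u == c) || (u == v); pose inS' u := (u == b) || (u == v').
pose A u := ~~ inS u && l u; pose B u := ~~ inS u && ~~ l u.
pose A' u := ~~ inS' u && l' u; pose C' u := ~~ inS' u && ~~ l' u.
have Astep u w : A u -> adj u w -> u != a -> A w || inS w.
  case/andP=> uS lu uw ua; rewrite /A; have [//|wS] /= := boolP (inS w).
  rewrite orbF; apply/negPn/negP => lw.
  have [||E _] := cross u w _ _ uw lu lw; rewrite ?notin -?negb_or //.
  by rewrite E eqxx in ua.
have Bstep u w : B u -> adj u w -> u != b -> B w || inS w.
  case/andP=> uS lu uw ub; rewrite /B; have [//|wS] /= := boolP (inS w).
  rewrite orbF; apply/negP => lw; rewrite adj_sym in uw.
  have [||_ E] := cross w u _ _ uw lw lu; rewrite ?notin -?negb_or //.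
  by rewrite E eqxx in ub.
have A'step u w : A' u -> adj u w -> u != a -> A' w || inS' w.
  case/andP=> uS lu uw ua; rewrite /A'; have [//|wS] /= := boolP (inS' w).
  rewrite orbF; apply/negPn/negP => lw.
  have [||E _] := cross' u w _ _ uw lu lw; rewrite ?notin -?negb_or //.
  by rewrite E eqxx in ua.
have C'step u w : C' u -> adj u w -> u != c -> C' w || inS' w.
  case/andP=> uS lu uw uc; rewrite /C'; have [//|wS] /= := boolP (inS' w).
  rewrite orbF; apply/negP => lw; rewrite adj_sym in uw.
  have [||_ E] := cross' w u _ _ uw lw lu; rewrite ?notin -?negb_or //.
  by rewrite E eqxx in uc.
have Sa : ~~ inS a by rewrite /inS negb_or nac eq_sym.
have Sb : ~~ inS b by rewrite /inS negb_or nbc eq_sym.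
have S'a : ~~ inS' a by rewrite /inS' negb_or nab eq_sym.
have S'c : ~~ inS' c by rewrite /inS' negb_or eq_sym nbc eq_sym.
have Aa w : adj a w -> w != b -> A w || inS w.
  move=> aw wb; rewrite /A; have [//|wS] /= := boolP (inS w).
  rewrite orbF; apply/negPn/negP => lw.
  have [||_ E] := cross a w _ _ aw la lw; rewrite ?notin -?negb_or //.
  by rewrite E eqxx in wb.
have A'a w : adj a w -> w != c -> A' w || inS' w.
  move=> aw wc; rewrite /A'; have [//|wS] /= := boolP (inS' w).
  rewrite orbF; apply/negPn/negP => lw.
  have [||_ E] := cross' a w _ _ aw la' lw; rewrite ?notin -?negb_or //.
  by rewrite E eqxx in wc.
have Bb w : adj b w -> w != a -> B w || inS w.
  move=> bw wa; rewrite /B; have [//|wS] /= := boolP (inS w).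
  rewrite orbF; apply/negP => lw; rewrite adj_sym in bw.
  have [||E _] := cross w b _ _ bw lw lb; rewrite ?notin -?negb_or //.
  by rewrite E eqxx in wa.
have Ac : A c = false by rewrite /A /inS eqxx.
have Bc : B c = false by rewrite /B /inS eqxx.
have Av : A v = false by rewrite /A /inS eqxx orbT.
have Bv : B v = false by rewrite /B /inS eqxx orbT.
have A'b : A' b = false by rewrite /A' /inS' eqxx.
have C'b : C' b = false by rewrite /C' /inS' eqxx.
have A'v' : A' v' = false by rewrite /A' /inS' eqxx orbT.
have A'c : A' c = false by rewrite /A' (negPf lc') andbF.
have Ab : A b = false by rewrite /A (negPf lb) andbF.
have Ba : B a = false by rewrite /B la andbF.
have BA u : B u -> A u = false by rewrite /A /B => /andP[-> /negPf->].
have CA u : C' u -> A' u = false by rewrite /A' /C' => /andP[-> /negPf->].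
(* If the quadrant of [A] and [A'] contains more than [a], its boundary must include both [v] and
   [v'], as two vertices cannot cut it off. If it is just [a], the degree of [a] forces [v] and [v']
   to be distinct neighbours of [a]. *)
have [A'v Av'] : A' v /\ A v'.
  have [a1 /and3P[Aa1 A'a1 a1a]|none] := pickP (fun u => [&& A u, A' u & u != a]).
    pose X u := [&& A u, A' u & u != a].
    have Xa1 : X a1 by rewrite /X Aa1 A'a1.
    have Xa : ~~ X a by rewrite /X eqxx !andbF.
    have [Xb Xc] : ~~ X b /\ ~~ X c by rewrite /X Ab Ac.
    have [Xv Xv'] : ~~ X v /\ ~~ X v' by rewrite /X Av A'v' andbF.
    have Xstep u w : X u -> adj u w -> [|| X w, w == a, (w == v) && (A' w || inS' w)
        | (w == v') && (A w || inS w)].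
      case/and3P=> Au A'u ua uw; have := Astep u w Au uw ua.
      have := A'step u w A'u uw ua; rewrite /X.
      have [_|wa] := eqVneq w a; first by rewrite !orbT.
      rewrite !andbT /inS /inS'; have [->|wc] := eqVneq w c.
        by rewrite A'c !(eq_sym c) (negPf nbc) (negPf v'c).
      have [->|wb] := eqVneq w b; first by rewrite Ab (eq_sym b v) (negPf vb) => _.
      by case: (A w) (A' w) (w == v) (w == v') => [] [] [] [].
    split; apply/negPn/negP => nA.
      suff : ~~ X a1 by rewrite Xa1.
      apply: (@no_two_cut _ X a v' c G3) => [u w Xu uw|||||] //.
      - case/or4P: (Xstep u w Xu uw) => [->//|->|/andP[/eqP wv]|/andP[-> _]]; rewrite ?orbT //.
        by rewrite wv (negPf nA) /inS' (negPf vb) /= => ->; rewrite !orbT.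
      - by rewrite eq_sym.
      by rewrite eq_sym.
    suff : ~~ X a1 by rewrite Xa1.
    apply: (@no_two_cut _ X a v b G3) => [u w Xu uw|||||] //.
    - case/or4P: (Xstep u w Xu uw) => [->//|->|/andP[-> _]|/andP[/eqP wv]]; rewrite ?orbT //.
      by rewrite wv (negPf nA) /inS (negPf v'c) /= => ->; rewrite !orbT.
    - by rewrite eq_sym.
    by rewrite eq_sym.
  have [|vv' cv bv' vn v'n] := @card_sub4 _ (nbrs a) b c v v' da.
    move=> w; rewrite !inE => aw.
    have [//|wb] := eqVneq w b; have [//|wc] := eqVneq w c; rewrite /=.
    have := Aa w aw wb; have := A'a w aw wc; have := none w.
    have -> : w != a by apply: contraTneq aw => ->; rewrite adj_irr.
    rewrite andbT /inS /inS' (negPf wb) (negPf wc) /=.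
    by case: (A w) (A' w) (w == v) (w == v') => [] [] [] [].
  rewrite !inE in vn v'n; split.
    have := A'a v vn; rewrite /inS' (negPf vb) (negPf vv') !orbF; apply.
    by rewrite eq_sym.
  have := Aa v' v'n; rewrite /inS (negPf v'c) (eq_sym v' v) (negPf vv') !orbF; apply.
  by rewrite eq_sym.
have v'S : ~~ inS v' by case/andP: Av'.
have vS' : ~~ inS' v by case/andP: A'v.
have Bv' : B v' = false by apply/negP => /BA; rewrite Av'.
have C'v : C' v = false by apply/negP => /CA; rewrite A'v.
(* This quadrant is bounded by [b] and [c]: the vertices [v] and [v'] lie on the sides [A'] and
   [A]. *)
have BC u : ~~ (B u && C' u).
  apply: (@no_two_cut _ (fun u => B u && C' u) b c a G3); rewrite ?C'b ?Bc ?Ba ?andbF //.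
  move=> {}u w /andP[Bu C'u] uw.
  have ub : u != b by apply: contraTneq C'u => ->; rewrite C'b.
  have uc : u != c by apply: contraTneq Bu => ->; rewrite Bc.
  have := Bstep u w Bu uw ub; have := C'step u w C'u uw uc; rewrite /inS /inS'.
  have [_|wb] := eqVneq w b; first by rewrite /= !orbT.
  have [_|wc] := eqVneq w c; first by rewrite /= !orbT.
  have [->|wv] := eqVneq w v.
    by rewrite C'v /= -[v == v']orFb -(negPf vb) -/(inS' v) (negPf vS').
  have [->|wv'] := eqVneq w v'; first by rewrite Bv' /=.
  by rewrite !orbF => -> ->.
(* This quadrant is bounded by [b] and [v]. So [b] is alone in [B], and its neighbours are among
   [a], [c], [v]. *)
have BA' u : ~~ (B u && A' u).
  apply: (@no_two_cut _ (fun u => B u && A' u) v b a G3);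
    rewrite ?A'b ?Bv ?Ba ?andbF //; last by rewrite eq_sym.
  move=> {}u w /andP[Bu A'u] uw.
  have ub : u != b by apply: contraTneq A'u => ->; rewrite A'b.
  have ua : u != a by apply: contraTneq Bu => ->; rewrite Ba.
  have := Bstep u w Bu uw ub; have := A'step u w A'u uw ua; rewrite /inS /inS'.
  have [_|wb] := eqVneq w b; first by rewrite /= !orbT.
  have [->|wc] := eqVneq w c; first by rewrite A'c (eq_sym c) (negPf v'c).
  have [_|wv] := eqVneq w v; first by rewrite /= !orbT.
  have [->|wv'] := eqVneq w v'; first by rewrite Bv' /=.
  by rewrite !orbF => -> ->.
have Bonly u : B u -> u = b.
  move=> Bu; apply/eqP/negPn/negP => ub.
  have uv' : u != v' by apply: contraTneq Bu => ->; rewrite Bv'.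
  have := BC u; have := BA' u; rewrite Bu /A' /C' /inS' (negPf ub) (negPf uv') /=.
  by case: (l' u).
suff : #|nbrs b| <= 3 by rewrite leqNgt db.
apply: leq_trans (card_size [:: a; c; v]); apply: subset_leq_card; apply/subsetP=> w.
rewrite !inE => bw; have [//|wa] /= := eqVneq w a.
have := Bb w bw wa; rewrite /inS => /orP[/Bonly wb|//].
by move: bw; rewrite wb adj_irr.
Qed.

(** * Polyhedra without reductions are pyramids *)

Section Rigid.
Variables (D : finType) (e n : {perm D}) (G : sgraph) (nu : D -> G).
Hypotheses (pm : polyhedral_map e n) (rG : realizes e n nu).
Local Notation f := (e * n)%g.

(** In a polyhedral map all orbits of [n] and [e * n] have at least 3 elements, so this means degree
    3 for [n] and a triangle for [e * n]. *)
Definition trivalent (s : {perm D}) x := s (s (s x)) == x.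

Lemma trivalent_step (s : {perm D}) x : trivalent s (s x) = trivalent s x.
Proof. by rewrite /trivalent (inj_eq perm_inj). Qed.

Lemma trivalent_other x : trivalent n (f x) = trivalent n (e x).
Proof. by rewrite permM trivalent_step. Qed.

Lemma card_porbit_trivalent x : (#|porbit n x| == 3) = trivalent n x.
Proof.
apply/eqP/eqP => [E|nx]; first by have := iter_porbit n x; rewrite E.
apply/eqP; rewrite eqn_leq (degree_ge3 pm) // andbT.
rewrite (leq_trans _ (card_size [:: x; n x; n (n x)])) // subset_leq_card //.
apply/subsetP; apply: porbit_closed => [z|]; last by rewrite !inE eqxx.
by rewrite !inE => /or3P[]/eqP->; rewrite ?nx eqxx ?orbT.
Qed.

Lemma card_nbrs x : #|nbrs (nu x)| = #|porbit n x|.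
Proof.
rewrite -(card_in_imset (f := nu \o e) (D := mem (porbit n x))) => [|y z yx zx].
  apply: eq_card => v; rewrite inE; apply/idP/imsetP => [/(rz_adj rG)[y [yx yv]]|].
    by exists y => //; apply/eq_porbit_in/(rz_vertex rG).
  by case=> y /eq_porbit_in/(rz_vertex rG) <- ->; apply: (pm_nu_adj rG).
apply: (realizes_simple pm rG); apply/(rz_vertex rG).
by rewrite (iffRL (eq_porbit_in _ _ _) yx) (iffRL (eq_porbit_in _ _ _) zx).
Qed.

(** Used at the three darts of a triangle, it leaves at most one corner of degree above 3. *)
Lemma triangle_trivalent :
  (forall x, ~ three_connected (del_edge (nu x) (nu (e x)))) ->
  forall x, trivalent f x -> trivalent n x \/ trivalent n (f x).
Proof.
move=> nodel x /eqP fx; have [|x4] := boolP (trivalent n x); first by left.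
have [|fx4] := boolP (trivalent n (f x)); first by right.
have deg4 y : ~~ trivalent n y -> 3 < #|nbrs (nu y)|.
  by move=> y4; rewrite card_nbrs ltn_neqAle eq_sym card_porbit_trivalent y4 (degree_ge3 pm).
have ea : nu (e (f (f x))) = nu x by rewrite -(pm_nu_face rG) fx.
have [||||||/nodel//|] := @triangle_deletion G (nu x) (nu (e x)) (nu (f (f x))).
- exact: three_connected_of_polyhedral rG.
- exact: (pm_nu_adj rG).
- by rewrite -ea adj_sym; apply: (pm_nu_adj rG).
- by rewrite (pm_nu_face rG) -(pm_nu_face rG x); apply: (pm_nu_adj rG).
- exact: deg4.
- by rewrite -(pm_nu_face rG); apply: deg4.
rewrite -ea -{2}[f (f x)](pm_inv pm) => H.
by case: (nodel _ H).
Qed.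

(** The two ends have no neighbours besides each other and the two apexes, so a fifth vertex would
    be separated from them by the apexes. *)
Lemma two_triangles_K4 y : trivalent f y -> trivalent f (e y) ->
  trivalent n y -> trivalent n (e y) -> #|G| <= 4.
Proof.
move=> /eqP fy /eqP fey /eqP ny /eqP ney; have eK := pm_inv pm.
have fE z : f z = n (e z) by rewrite permM.
pose c := nu (f (f y)); pose d := nu (f (f (e y))).
have effy : e (f (f y)) = n (n y).
  by apply: (@perm_inj _ n); rewrite -fE fy ny.
have effey : e (f (f (e y))) = n (n (e y)).
  by apply: (@perm_inj _ n); rewrite -fE fey ney.
have three z v : n (n (n z)) = z -> adj (nu z) v ->
    [|| v == nu (e z), v == nu (e (n z)) | v == nu (e (n (n z)))].
  move=> nz /(rz_adj rG)[w [/(rz_vertex rG)/eq_porbit_in wz <-]].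
  suff : w \in [:: z; n z; n (n z)].
    by rewrite !inE => /or3P[]/eqP->; rewrite eqxx ?orbT.
  apply: (porbit_closed (s := n)) wz => [t|]; last by rewrite !inE eqxx.
  by rewrite !inE => /or3P[]/eqP->; rewrite ?nz eqxx ?orbT.
have a_nb v : adj (nu y) v -> [|| v == nu (e y), v == d | v == c].
  by move/(three _ _ ny); rewrite -effy eK -/c /d (pm_nu_face rG (f (e y))) fE eK.
have b_nb v : adj (nu (e y)) v -> [|| v == nu y, v == c | v == d].
  by move/(three _ _ ney); rewrite -effey !eK -/d /c (pm_nu_face rG (f y)) fE.
pose X v := (v == nu y) || (v == nu (e y)).
have Xc : ~~ X c.
  rewrite /X negb_or /c {2}(pm_nu_face rG) -(pm_nu_face rG y) (pm_nu_noloop pm rG) andbT.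
  have := pm_nu_noloop pm rG (e (f (f y))); rewrite eK effy.
  by rewrite !(pm_nu_next rG).
have Xd : ~~ X d.
  rewrite /X negb_or /d {1}(pm_nu_face rG) -{2}[y]eK -(pm_nu_face rG (e y)).
  rewrite (pm_nu_noloop pm rG) /=.
  have := pm_nu_noloop pm rG (e (f (f (e y)))); rewrite eK effey.
  by rewrite !(pm_nu_next rG).
rewrite -cardsT (leq_trans _ (card_size [:: nu y; nu (e y); c; d])) //.
apply: subset_leq_card; apply/subsetP=> z _; rewrite !inE.
apply/negPn/negP; rewrite !negb_or => /and4P[zy zey zc zd].
have G3 := three_connected_of_polyhedral pm rG.
have : ~~ X (nu y).
  apply: (@no_two_cut _ X c d z G3) => //; last by rewrite /X negb_or zy.
  by move=> u w /orP[]/eqP-> => [/a_nb|/b_nb]; rewrite /X => /or3P[]->; rewrite ?orbT.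
by rewrite /X eqxx.
Qed.

(** The dart leaves the future hub; [f x] and [f (f x)] start at two consecutive rim vertices. *)
Definition spoke x :=
  [&& trivalent f x, trivalent n (f x) & trivalent n (f (f x))].

Lemma spoke_next x : 4 < #|G| ->
  (forall y, trivalent f y -> trivalent n y \/ trivalent n (f y)) ->
  (forall y, trivalent n y -> trivalent f y \/ trivalent f (n y)) ->
  spoke x -> spoke (n x).
Proof.
move=> G4 P1 P2 /and3P[fx nfx nffx]; have eK := pm_inv pm.
have K4 y : trivalent f y -> trivalent f (e y) -> trivalent n y ->
    trivalent n (e y) -> False.
  by move=> y1 y2 y3 y4; have := two_triangles_K4 y1 y2 y3 y4; rewrite leqNgt G4.
have fE z : f (e z) = n z by rewrite permM eK.
have tn z : trivalent f (n z) = trivalent f (e z) by rewrite -fE trivalent_step.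
have nnf : n (n (f x)) = e x.
  by apply: (@perm_inj _ n); rewrite (eqP nfx) permM.
have fnx : trivalent f (n x).
  rewrite tn -nnf; have := P2 (n (f x)); rewrite trivalent_step => /(_ nfx)[|//].
  rewrite tn => H; exfalso; apply: (K4 (f x)); rewrite ?trivalent_step //.
  by rewrite -trivalent_other.
have ffn : f (f (n x)) = e x.
  by apply: (@perm_inj _ f); rewrite (eqP fnx) fE.
have nex : trivalent n (e x) by rewrite -trivalent_other.
rewrite /spoke fnx ffn nex andbT /=.
have [|//] := P1 (n x) fnx; rewrite trivalent_step => nx.
by case: (K4 x); rewrite // -tn.
Qed.

Lemma spoke_wheel x : (forall y, y \in porbit n x -> spoke y) ->
  giso (wheel #|porbit n x|) G.
Proof.
move=> Q; have eK := pm_inv pm; set k := #|porbit n x|.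
have fE z : f (e z) = n z by rewrite permM eK.
have orb y : porbit n y = porbit n x -> spoke y by move/eq_porbit_in/Q.
have rim y v : porbit n y = porbit n x ->
    adj (nu (e y)) v = [|| v == nu x, v == nu (e (n y)) | v == nu (e (n^-1%g y))].
  move=> yx; have /and3P[fy nfy nffy] := orb _ yx.
  have /and3P[fny _ _] : spoke (n y) by apply: orb; rewrite porbit_step.
  have ffn : f (f (n y)) = e y by apply: (@perm_inj _ f); rewrite (eqP fny) fE.
  have eff : e (f (f y)) = n^-1%g y.
    by apply: (@perm_inj _ n); rewrite permKV -permM (eqP fy).
  have third : n (n (e y)) = e (f (n y)).
    apply: (@perm_inj _ n); rewrite -[n (e (f (n y)))]permM ffn.
    by move: nfy; rewrite trivalent_other => /eqP.
  have ends : [/\ nu y = nu x, nu (f (n y)) = nu (e (n y)) & nu (f (f y)) = nu (e (n^-1%g y))].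
    by split; [apply/(rz_vertex rG) | apply: pm_nu_face | rewrite -eff eK].
  have [yE fnE ffE] := ends.
  apply/idP/or3P => [/(rz_adj rG)[w [/(rz_vertex rG)/eq_porbit_in wey <-]]|].
    have : w \in [:: e y; n (e y); n (n (e y))].
      apply: (porbit_closed (s := n)) wey => [t|]; last by rewrite !inE eqxx.
      rewrite !inE => /or3P[]/eqP->; rewrite ?eqxx ?orbT //.
      by move: nfy; rewrite trivalent_other => /eqP->; rewrite eqxx.
    rewrite !inE => /or3P[]/eqP->.
    - by rewrite eK yE; constructor 1.
    - by rewrite -(pm_nu_face rG) -[n (e y)]permM ffE; constructor 3.
    by rewrite third eK fnE; constructor 2.
  case=> /eqP->; apply/(rz_adj rG).
  - by exists (e y); rewrite eK yE.
  - by exists (n (n (e y))); rewrite !(pm_nu_next rG) third eK fnE.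
  by exists (n (e y)); rewrite (pm_nu_next rG) -(pm_nu_face rG (n (e y))) -[n (e y)]permM ffE.
pose y i := iter i n x.
have yx i : porbit n (y i) = porbit n x.
  by elim: i => //= i IHi; rewrite porbit_step.
have yk : y k = x by apply: iter_porbit.
have yS (i : 'I_k) : y (ordS i) = n (y i).
  rewrite /= -iterS; have := ltn_ord i; rewrite leq_eqVlt => /orP[/eqP E|ik].
    by rewrite E modnn -[in RHS]E -/(y _) E yk.
  by rewrite modn_small.
have y_inj (i j : 'I_k) : y i = y j -> i = j.
  have := uniq_traject_porbit n x; rewrite -/k => us E.
  have := nth_uniq x (i := i) (j := j) _ _ us.
  rewrite size_traject => /(_ (ltn_ord i) (ltn_ord j)).
  by rewrite !nth_traject ?ltn_ord // -/(y i) -/(y j) E eqxx => /esym/eqP/val_inj.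
have y_surj w : porbit n w = porbit n x -> exists i : 'I_k, y i = w.
  move/eq_porbit_in; rewrite porbit_traject => /trajectP[i ik ->].
  by exists (Ordinal ik).
have spoke_eq v w : porbit n v = porbit n x -> porbit n w = porbit n x ->
    (nu (e v) == nu (e w)) = (v == w).
  move=> vx wx; apply/eqP/eqP => [E|->//]; apply: (realizes_simple pm rG) E.
  by apply/(rz_vertex rG); rewrite vx.
pose h (u : option 'I_k) := if u is Some i then nu (e (y i)) else nu x.
have hub i : nu x != nu (e (y i)).
  rewrite eq_sym; have := pm_nu_noloop pm rG (y i).
  by have /(rz_vertex rG) -> := yx i.
exists h.
  apply: inj_surj_bij.
    case=> [i|] [j|] //= /eqP; last by rewrite (negPf (hub _)).
      by rewrite spoke_eq // => /eqP/y_inj->.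
    by rewrite eq_sym (negPf (hub _)).
  (* The image of [h] is closed under adjacency, so connectedness makes it everything. *)
  pose l v := [exists u, h u == v].
  suff lG v : l v by move=> v; have /existsP[u /eqP] := lG v; exists u.
  have l0 : l (nu x) by apply/existsP; exists None.
  rewrite (@label_const _ _ _ pm _ _ rG l _ v (nu x)) //.
  have half a b : adj a b -> l a -> l b.
    move=> + /existsP[u /eqP ua]; rewrite -ua; case: u {ua} => [i|] /=.
      rewrite rim // => /or3P[]/eqP-> //.
        by apply/existsP; exists (Some (ordS i)); rewrite /= -/(y _) -/(ordS i) yS.
      have [j jE] : exists j : 'I_k, y j = n^-1%g (y i) by apply: y_surj; rewrite porbit_stepV.
      by apply/existsP; exists (Some j); rewrite /= jE.
    case/(rz_adj rG)=> w [/(rz_vertex rG)/y_surj[j <-] <-].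
    by apply/existsP; exists (Some j).
  move=> a b ab; apply/idP/idP; apply: half => //; by rewrite adj_sym.
have spoke_adj i : adj (nu x) (nu (e (y i))).
  by apply/(rz_adj rG); exists (y i); split=> //; apply/(rz_vertex rG).
case=> [i|] [j|] /=; rewrite ?adj_irr ?spoke_adj //; last by rewrite adj_sym spoke_adj.
rewrite rim // eq_sym (negPf (hub _)) /= !spoke_eq ?porbit_step ?porbit_stepV //.
have -> : (y j == n (y i)) = (j == ordS i).
  by rewrite -yS; apply/eqP/eqP => [/y_inj|->].
have -> : (y j == n^-1%g (y i)) = (i == ordS j).
  rewrite eq_sym -(inj_eq (@perm_inj _ n)) permKV -yS.
  by apply/eqP/eqP => [/y_inj|->].
have ord_neq (a : 'I_k) : a != ordS a.
  by apply/eqP=> E; have := pm_degree1 pm (y a); rewrite -yS -E eqxx.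
have [<-|//] := eqVneq i j; by rewrite (negPf (ord_neq i)).
Qed.

End Rigid.

(** Otherwise 4V and 4F are both at most 2E, so V + F is at most E. *)
Lemma small_face_or_vertex (D : finType) (e n : {perm D}) :
  polyhedral_map e n -> exists x, trivalent n x \/ trivalent (e * n)%g x.
Proof.
move=> pm; have pm' := polyhedral_map_dual pm.
have [x /orP xP|none] := pickP (fun x => trivalent n x || trivalent (e * n)%g x).
  by exists x.
have deg4 x : 4 <= #|porbit n x|.
  rewrite ltn_neqAle eq_sym (card_porbit_trivalent pm) (degree_ge3 pm) andbT.
  by have := none x => /norP[].
have len4 x : 4 <= #|porbit (e * n)%g x|.
  rewrite ltn_neqAle eq_sym (card_porbit_trivalent pm') (degree_ge3 pm') andbT.
  by have := none x => /norP[].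
have := porbits_lower_bound deg4; have := porbits_lower_bound len4.
have := pm_euler pm; lia.
Qed.

(** * Avoiding the excluded pyramids *)

(* The degree sequence of a pyramid other than the square one. *)
Definition wheel_like (G : sgraph) : bool :=
  (#|G| != 5) && [exists h : G, (#|nbrs h|.+1 == #|G|) &&
    [forall v, (v != h) ==> (#|nbrs v| == 3)]].

Lemma three_connected_card_nbrs (G : sgraph) (u : G) :
  three_connected G -> 2 < #|nbrs u|.
Proof.
move=> G3; rewrite ltnNge; apply/negP; rewrite -ltnS => S3.
by have [v uv] := three_connected_neighbour u G3 S3; rewrite inE uv.
Qed.

Lemma nbrs_sub (G : sgraph) (u : G) : nbrs u \subset ~: [set u].
Proof.
by apply/subsetP=> v; rewrite !inE; apply: contraTneq => ->; rewrite adj_irr.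
Qed.

Lemma card_nbrs_lt (G : sgraph) (u : G) : #|nbrs u| < #|G|.
Proof.
have G0 : 0 < #|G| by apply/card_gt0P; exists u.
by rewrite -(prednK G0) ltnS -(cardsC1 u) subset_leq_card // nbrs_sub.
Qed.

Lemma full_nbrs (G : sgraph) (h v : G) :
  #|nbrs h|.+1 = #|G| -> v != h -> adj h v.
Proof.
move=> hG vh; have : v \in nbrs h; last by rewrite inE.
suff -> : nbrs h = ~: [set h] by rewrite !inE.
apply/eqP; rewrite eqEcard nbrs_sub /=.
by rewrite cardsCs setCK cards1 -hG subn1.
Qed.

Lemma wheel_is_wheel_like (G : sgraph) m : three_connected G ->
  3 <= m -> m <> 4 -> giso (wheel m) G -> wheel_like G.
Proof.
move=> G3 m3 m4 [g gbij gmono]; have ginj := bij_inj gbij.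
have cG : #|G| = m.+1.
  by rewrite -(bij_eq_card gbij) card_option card_ord.
have nb u : nbrs (g u) = g @: nbrs u.
  apply/setP=> v; have [k gk kg] := gbij; rewrite inE -[v]kg gmono.
  by rewrite mem_imset // inE.
apply/andP; split; first by rewrite cG; apply/eqP => -[].
apply/existsP; exists (g None); apply/andP; split.
  rewrite nb card_imset // cG eqSS.
  have -> : nbrs (None : wheel m) = ~: [set None].
    by apply/setP=> -[i|]; rewrite !inE.
  by rewrite cardsCs setCK cards1 card_option card_ord subn1.
apply/forallP=> v; apply/implyP; have [k gk kg] := gbij; rewrite -[v]kg (inj_eq ginj).
case: (k v) => [i _|]; last by rewrite eqxx.
rewrite eqn_leq three_connected_card_nbrs // andbT nb card_imset //.
rewrite (leq_trans _ (card_size [:: None; Some (ordS i); Some (ord_pred i)])) //.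
apply: subset_leq_card; apply/subsetP=> -[j|]; rewrite !inE //=.
case/andP=> _ /orP[/eqP->|/eqP->]; first by rewrite eqxx.
by rewrite ordSK eqxx orbT.
Qed.

Lemma three_connected_small (G : sgraph) :
  three_connected G -> #|G| <= 4 -> giso (wheel 3) G.
Proof.
move=> G3 G4; have cG : #|G| = 4 by apply/eqP; rewrite eqn_leq G4; case: G3.
have complete (u v : G) : v != u -> adj u v.
  apply: full_nbrs; apply/eqP; rewrite eqn_leq card_nbrs_lt cG ltnS.
  exact: three_connected_card_nbrs.
have cW : #|wheel 3| = #|G| by rewrite card_option card_ord cG.
pose h (u : wheel 3) : G := enum_val (cast_ord cW (enum_rank u)).
have h_inj : injective h by move=> u v /enum_val_inj/cast_ord_inj/enum_rank_inj.
exists h; first by apply: inj_card_bij; rewrite ?cW.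
move=> u v; have [->|uv] := eqVneq u v; first by rewrite !adj_irr.
rewrite complete; last by rewrite (inj_eq h_inj) eq_sym.
by move: u v uv {h_inj} => [[[|[|[|i]]] ?]|] [[[|[|[|j]]] ?]|].
Qed.

Lemma add_del_edge (G : sgraph) (p q : G) :
  adj p q -> giso (add_edge (p : del_edge p q) q) G.
Proof.
move=> pq; exists id; first by exists id.
move=> u v; rewrite /= /add_edge_adj /= /del_edge_adj.
have [uv|uv] := boolP (@adj G u v) => /=.
  have -> : u != v by apply: contraTneq uv => ->; rewrite adj_irr.
  exact/esym/orNb.
apply/esym/negP => /and3P[nuv /set2P[]uE /set2P[]vE]; move: uv nuv.
- by rewrite uE vE eqxx.
- by rewrite uE vE pq.
- by rewrite uE vE adj_sym pq.
by rewrite uE vE eqxx.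
Qed.

(* If deleting pq leaves a wheel with hub h, delete the spoke ph instead. *)
Lemma avoid_wheel_like (G : sgraph) (p q : G) : three_connected G -> adj p q ->
  three_connected (del_edge p q) -> wheel_like (del_edge p q) ->
  exists2 h, adj p h &
    three_connected (del_edge p h) /\ ~~ wheel_like (del_edge p h).
Proof.
move=> G3 pq H3 /andP[G5 wh].
have npq : p != q by apply: contraTneq pq => ->; rewrite adj_irr.
have [h [hub degH hubadj]] : exists h : G,
    [/\ #|[set w | del_edge_adj p q h w]|.+1 = #|G|,
        forall v : G, v != h -> #|[set w | del_edge_adj p q v w]| = 3
      & forall v : G, v != h -> del_edge_adj p q h v].
  have /existsP[h /andP[/eqP hub /forallP rim]] := wh; exists h; split=> // v vh.
    by have := rim v; rewrite vh => /eqP.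
  by have := full_nbrs hub vh.
have ph : p != h.
  apply/eqP => E; have := hubadj q; rewrite -E eq_sym npq => /(_ isT).
  by rewrite /del_edge_adj !inE !eqxx orbT andbF.
have qh : q != h.
  apply/eqP => E; have := hubadj p; rewrite -E npq => /(_ isT).
  by rewrite /del_edge_adj !inE !eqxx orbT andbF.
have Ghub v : v != h -> adj h v by move/hubadj/andP=> [].
have nbG (v : G) : nbrs v \subset (if v == p then q else p) |: [set w | del_edge_adj p q v w].
  apply/subsetP=> w; rewrite !inE /del_edge_adj => vw; rewrite vw /= !inE.
  have wv : w != v by apply: contraTneq vw => ->; rewrite adj_irr.
  have [vp|vp] := eqVneq v p.
    by rewrite -vp (negPf wv); case: (w == q).
  have [//|wp] := eqVneq w p; rewrite /=.
  by have [vq|vq] := eqVneq v q; rewrite // -vq (negPf wv).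
have deg4 (v : G) : v != h -> #|nbrs v| <= 4.
  move=> vh; apply: leq_trans (subset_leq_card (nbG v)) _.
  by rewrite cardsU1 degH //; case: (_ \notin _).
have degp : #|nbrs p| = 4.
  have -> : nbrs p = q |: [set w | del_edge_adj p q p w].
    apply/eqP; rewrite eqEsubset; have := nbG p; rewrite eqxx => -> /=.
    by apply/subsetP=> w; rewrite !inE => /orP[/eqP->//|/andP[]].
  by rewrite cardsU1 degH // inE /del_edge_adj !inE !eqxx orbT andbF.
(* [c] is a rim neighbour of [p], so [p], [h], [c] form a triangle in which only [c] has degree
   3. *)
have [c [pc ch cq]] : exists c : G, [/\ adj p c, c != h & c != q].
  have /card_gt0P[c] : 0 < #|nbrs p :\ h :\ q|.
    have := cardsD1 h (nbrs p); have := cardsD1 q (nbrs p :\ h); rewrite degp.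
    by case: (h \in _); case: (q \in _); lia.
  by rewrite !inE => /and3P[cq ch pc]; exists c.
have degc : #|nbrs c| <= 3.
  have cp : c != p by apply: contraTneq pc => ->; rewrite adj_irr.
  rewrite -(degH c ch); apply: subset_leq_card; apply/subsetP=> w.
  by rewrite !inE /del_edge_adj !inE (negPf cp) (negPf cq) => ->.
have degh : #|nbrs h|.+1 = #|G|.
  apply/eqP; rewrite eqn_leq; apply/andP; split.
    exact: card_nbrs_lt.
  rewrite -[#|G|]/#|del_edge p q| -hub ltnS; apply: subset_leq_card.
  by apply/subsetP=> w; rewrite !inE => /andP[].
have G6 : 5 < #|G|.
  rewrite ltn_neqAle eq_sym G5 /=.
  by rewrite -degp card_nbrs_lt.
have php : adj p h by rewrite adj_sym; apply: Ghub.
(* Deleting [p c] is impossible, as [c] would be left with degree 2. After deleting [p h] no hub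
   exists: [h] misses [p], and every other degree is at most 4 while there are at least 6
   vertices. *)
have [||H|H] := triangle_deletion G3 php pc (Ghub c ch).
- by rewrite degp.
- by rewrite -ltnS degh ltnW.
- exists h => //; split=> //; apply/negP => /andP[_ /existsP[h' /andP[/eqP hub' _]]].
  have sub (v : G) : [set w | del_edge_adj p h v w] \subset nbrs v.
    by apply/subsetP=> w; rewrite !inE => /andP[].
  have h'h : (h' : G) = h.
    apply/eqP/negPn/negP => h'h; move: G6; rewrite ltnNge => /negP[].
    have -> : #|G| = #|[set w | del_edge_adj p h h' w]|.+1 by rewrite [LHS](esym hub').
    by rewrite ltnS (leq_trans (subset_leq_card (sub h'))) ?deg4.
  have : @adj (del_edge p h) h' p by apply: full_nbrs; rewrite // h'h.
  by rewrite h'h /= /del_edge_adj !inE !eqxx orbT andbF.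
have := three_connected_card_nbrs (c : del_edge p c) H; rewrite ltnNge => /negP[].
apply: leq_trans (_ : #|nbrs c :\ p| <= 2).
  apply: subset_leq_card; apply/subsetP=> w; rewrite !inE => /andP[cw].
  rewrite cw andbT !inE eqxx orbT /= negb_or => /andP[wp _] //.
by move: degc; rewrite (cardsD1 p (nbrs c)) inE adj_sym pc.
Qed.

(* The n faces at the hub have at least 3 edges and the other face meets all n
   rim vertices; as the lengths add up to 4n, both bounds are attained. *)
Lemma wheel_like_dual (D : finType) (e n : {perm D}) (G H : sgraph)
    (nu : D -> G) (mu : D -> H) :
  polyhedral_map e n -> realizes e n nu -> realizes e (e * n)%g mu ->
  wheel_like G -> wheel_like H.
Proof.
set f := (e * n)%g => pm rG rH /andP[G5 /existsP[u /andP[/eqP hub /forallP rim]]].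
have pm' := polyhedral_map_dual pm; have eK := pm_inv pm.
have [x xu] := rz_surj rG u.
pose O := porbit n x.
have Onu y : (y \in O) = (nu y == u).
  rewrite -xu; apply/idP/eqP => [/eq_porbit_in/(rz_vertex rG)//|].
  by move/(rz_vertex rG)/eq_porbit_in.
have cO : #|O|.+1 = #|G| by rewrite -(card_nbrs pm rG) xu.
have deg3 y : nu y != u -> #|porbit n y| = 3.
  by move=> yu; rewrite -(card_nbrs pm rG); have := rim (nu y); rewrite yu => /eqP.
(* The hub contributes [#|O|] darts and each of the [#|O|] rim vertices contributes 3. *)
have cD : #|D| = 4 * #|O|.
  rewrite -cardsT (card_partition (partition_porbits n)).
  rewrite (big_setD1 O) ?imset_f //= (eq_bigr (fun=> 3)) => [|A].
    rewrite sum_nat_const; have := cardsD1 O (porbits n).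
    rewrite imset_f // -(card_realized rG) -cO add1n => -[<-].
    by rewrite mulnC mulSn.
  case/setD1P=> AO /imsetP[y _ AE]; rewrite AE deg3 // -Onu.
  by apply: contra AO => /eq_porbit_in yO; rewrite AE yO.
have cF : #|porbits f| = #|O|.+1.
  have := pm_euler pm; rewrite -(card_realized rG) -cO cD -/f.
  by rewrite -[4]/(2 * 2) -mulnA mul2n doubleK; lia.
have cornerO y z : y \in O -> z \in O -> porbit f y = porbit f z -> y = z.
  by move=> /eq_porbit_in yO /eq_porbit_in zO; apply: (pm_corner pm); rewrite yO.
pose Hub := [set porbit f y | y in O].
have cHub : #|Hub| = #|O| by apply: card_in_imset => y z; apply: cornerO.
have HubS : Hub \subset porbits f.
  by apply/subsetP=> _ /imsetP[y _ ->]; apply: imset_f.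
have [R RE] : exists R, porbits f :\: Hub = [set R].
  apply/cards1P; rewrite cardsD (setIidPr HubS) cHub cF.
  by rewrite subSn // subnn.
(* Of the three darts at a rim vertex, [e y] and [n (e y)] lie on hub faces; the two-face condition
   puts the third on the remaining face [R]. *)
pose t y := n (n (e y)).
have tR y : y \in O -> porbit f (t y) = R.
  move=> yO; apply/set1P; rewrite -RE; apply/setDP; split; first exact: imset_f.
  apply/imsetP=> -[z zO tz].
  have fny : porbit f (n y) = porbit f (e y) := pm_face_next pm y.
  have fney : porbit f (n (e y)) = porbit f y by rewrite (pm_face_next pm) eK.
  have tv : porbit n (t y) = porbit n (e y) by rewrite /t !porbit_step.
  have zy : porbit n z = porbit n y.
    by rewrite (iffRL (eq_porbit_in _ _ _) zO) (iffRL (eq_porbit_in _ _ _) yO).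
  have [||||||E|E] := pm_two_faces pm (x := y) (x' := z) (y := n (e y)) (y' := t y) => //.
  - by rewrite tv porbit_step.
  - by rewrite porbit_step => E; apply: (pm_noloop pm (x := y)).
  - move=> E; have := pm_degree1 pm (n (e y)); rewrite -/(t y) => /eqP[].
    by apply: (pm_corner pm); rewrite ?tv ?porbit_step // tz -E fney.
  - by have := pm_degree pm (e y); rewrite -/(t y) E eqxx.
  have yz : y = z by apply: (pm_simple pm) => //; rewrite -E porbit_step.
  by have := pm_degree1 pm (e y); rewrite E yz eqxx.
have t_inj : injective t by move=> y z /perm_inj/perm_inj/perm_inj.
have Rge : #|O| <= #|R|.
  rewrite -(card_imset _ t_inj); apply: subset_leq_card.
  by apply/subsetP=> _ /imsetP[y yO ->]; rewrite -(tR y yO) porbit_id.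
have sumF : 4 * #|O| = #|R| + \sum_(A in Hub) #|A|.
  rewrite -cD -cardsT (card_partition (partition_porbits f)).
  rewrite (big_setID Hub) /= (setIidPr HubS) RE big_set1 addnC //.
have Rx : R = porbit f (t x) by rewrite tR ?porbit_id.
have ge3 A : A \in Hub -> 3 <= #|A|.
  by case/imsetP=> y _ ->; apply: (degree_ge3 pm').
have hub_le A : A \in Hub -> #|A| <= 3.
  move=> AH; rewrite leqNgt; apply/negP => A4.
  suff : 3 * #|O| < \sum_(A in Hub) #|A| by lia.
  rewrite (big_setD1 A) //= -cHub (cardsD1 A) AH mulnDr muln1.
  rewrite -addSn leq_add // mulnC -sum_nat_const; apply: leq_sum => B.
  by case/setD1P=> _; apply: ge3.
have Rle : #|R| <= #|O|.
  suff : 3 * #|O| <= \sum_(A in Hub) #|A| by lia.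
  by rewrite -cHub mulnC -sum_nat_const; apply: leq_sum => B; apply: ge3.
have cH : #|H| = #|G| by rewrite (card_realized rH) -/f cF cO.
apply/andP; split; first by rewrite cH.
apply/existsP; exists (mu (t x)); apply/andP; split.
  rewrite (card_nbrs pm' rH) -/f -Rx cH -cO; apply/eqP; congr _.+1.
  by apply/eqP; rewrite eqn_leq Rle Rge.
apply/forallP=> v; apply/implyP; have [y <-] := rz_surj rH v => yt.
rewrite (card_nbrs pm' rH) -/f eqn_leq (degree_ge3 pm') andbT; apply: hub_le.
apply/negPn/negP => yH.
have : porbit f y \in porbits f :\: Hub by apply/setDP; split; first exact: imset_f.
rewrite RE Rx => /set1P/(rz_vertex rH) E; by rewrite E eqxx in yt.
Qed.

(** Decidability justifies the case distinction on the existence of a deletable edge. *)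
Lemma three_connectedP (G : sgraph) :
  reflect (three_connected G) ((3 < #|G|) &&
    [forall S : {set G}, (#|S| < 3) ==>
      [forall x, forall y, (x \notin S) ==> (y \notin S) ==>
        connect [rel u v | [&& adj u v, u \notin S & v \notin S]] x y]]).
Proof.
apply: (iffP andP) => -[G4 H]; split=> //.
  move=> S S3 x y xS yS; have /forallP/(_ S) := H; rewrite S3.
  by move=> /forallP/(_ x)/forallP/(_ y); rewrite xS yS.
apply/forallP=> S; apply/implyP=> S3; apply/forallP=> x; apply/forallP=> y.
by apply/implyP=> xS; apply/implyP=> yS; apply: H.
Qed.

(** * Generation *)

Section Reduction.
Variables (D : finType) (e n : {perm D}) (G : sgraph) (nu : D -> G).
Hypotheses (pm : polyhedral_map e n) (rG : realizes e n nu).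
Local Notation f := (e * n)%g.

Lemma deletable_or_not :
  (exists x, three_connected (del_edge (nu x) (nu (e x)))) \/
  (forall x, ~ three_connected (del_edge (nu x) (nu (e x)))).
Proof.
have [/existsP[x /three_connectedP xP]|/existsPn no] :=
  boolP [exists x, (fun G' : sgraph => (3 < #|G'|) &&
    [forall S : {set G'}, (#|S| < 3) ==>
      [forall x, forall y, (x \notin S) ==> (y \notin S) ==>
        connect [rel u v | [&& adj u v, u \notin S & v \notin S]] x y]])
    (del_edge (nu x) (nu (e x)))]; first by left; exists x.
by right=> x /three_connectedP xP; have := no x; rewrite xP.
Qed.

Lemma good_deletion x : three_connected (del_edge (nu x) (nu (e x))) ->
  exists2 y, three_connected (del_edge (nu y) (nu (e y))) &
    ~~ wheel_like (del_edge (nu y) (nu (e y))).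
Proof.
move=> H3; have [wl|] := boolP (wheel_like (del_edge (nu x) (nu (e x)))); last by exists x.
have G3 := three_connected_of_polyhedral pm rG.
have [h ph [h3 hw]] := avoid_wheel_like G3 (pm_nu_adj rG x) H3 wl.
have /(rz_adj rG)[y [yx yh]] := ph.
by exists y; rewrite yx yh.
Qed.

Lemma irreducible_wheel (H : sgraph) (mu : D -> H) :
  realizes e f mu ->
  (forall x, ~ three_connected (del_edge (nu x) (nu (e x)))) ->
  (forall x, ~ three_connected (del_edge (mu x) (mu (e x)))) ->
  exists2 m, 3 <= m & giso (wheel m) G.
Proof.
move=> rH nodel nodel'.
have G3 := three_connected_of_polyhedral pm rG.
have [G4|G4] := leqP #|G| 4; first by exists 3 => //; apply: three_connected_small.
have P1 := triangle_trivalent pm rG nodel.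
have P2 := triangle_trivalent (polyhedral_map_dual pm) rH nodel'.
rewrite (involution_mulg _ (pm_inv pm)) in P2.
have [x fx] : exists x, trivalent f x.
  have [x [nx|fx]] := small_face_or_vertex pm; last by exists x.
  by have [fx|fx] := P2 x nx; [exists x | exists (n x)].
have fstep y : trivalent f (f y) = trivalent f y := trivalent_step f y.
have fffx : f (f (f x)) = x by apply/eqP.
(* Two corners of the triangle are trivalent; the triangle is rotated so that the dart starts at the
   third. *)
have [y Qy] : exists y, spoke e n y.
  have := P1 x fx; have := P1 (f x); have := P1 (f (f x)).
  rewrite !fstep fffx => /(_ fx) H1 /(_ fx) H2 H3.
  have [nfx|nfx] := boolP (trivalent n (f x)).
    have [nffx|nffx] := boolP (trivalent n (f (f x))).
      by exists x; apply/and3P.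
    case: H1 => [E|nx]; first by rewrite E in nffx.
    by exists (f (f x)); rewrite /spoke !fstep fffx; apply/and3P.
  case: H3 => [nx|E]; last by rewrite E in nfx.
  case: H2 => [E|nffx]; first by rewrite E in nfx.
  by exists (f x); rewrite /spoke !fstep fffx; apply/and3P.
exists #|porbit n y|; first exact: (degree_ge3 pm).
apply: (spoke_wheel pm rG) => z zy; move: z zy.
apply: (porbit_closed (A := [pred z | spoke e n z])) => // z.
exact: (spoke_next pm rG).
Qed.

End Reduction.

(** The equation on [pgraph H] leaves open which proofs are packed with the graph. *)
Lemma del_edge_addition (G : polyhedron) (p q : G) (H : polyhedron) :
  pgraph H = del_edge p q -> adj p q -> edge_addition H G.
Proof.
case: H => H H3 Hp /= HE pq; rewrite /edge_addition /=.
move: H3 Hp; rewrite HE => _ _; exists p, q; split.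
- by apply: contraTneq pq => ->; rewrite adj_irr.
- by rewrite /= /del_edge_adj !inE !eqxx orbT /= andbF.
exact: add_del_edge.
Qed.

(** * The induction, common to both sets of operations *)

Section Generation.
Variable op : polyhedron -> polyhedron -> Prop.
Hypothesis op_edge : forall G H, edge_addition G H -> op G H.

Let smaller_generated (N : nat) := forall (D : finType) (e n : {perm D})
    (G : polyhedron) (nu : D -> G),
  #|D| < N -> polyhedral_map e n -> realizes e n nu -> ~~ wheel_like G ->
  generated op (wheel 4) G.

(* The remaining case of the induction: the dual has a deletable edge. *)
Hypothesis op_dual : forall (D : finType) (e n : {perm D}) (G H : polyhedron)
    (nu : D -> G) (mu : D -> H) x,
  smaller_generated #|D| -> polyhedral_map e n -> realizes e n nu ->
  realizes e (e * n)%g mu ->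
  three_connected (del_edge (mu x) (mu (e x))) ->
  ~~ wheel_like (del_edge (mu x) (mu (e x))) ->
  generated op (wheel 4) G.

Lemma card_kept (D : finType) (e : {perm D}) x :
  #|{: {y : D | y \notin [set x; e x]}}| < #|D|.
Proof.
rewrite card_sig; apply: proper_card; apply/properP; split; first exact/subsetP.
by exists x; rewrite // !inE eqxx.
Qed.

Lemma not_wheel_like (G : polyhedron) : ~~ wheel_like G ->
  forall m, 3 <= m -> m <> 4 -> ~ giso (wheel m) G.
Proof.
move=> /negP wG m m3 m4 mG; apply: wG.
exact: wheel_is_wheel_like (polyhedron_3connected G) m3 m4 mG.
Qed.

(** The conclusion is wanted for all [G] that are not excluded pyramids, whereas the induction
    hypothesis asks for [~~ wheel_like], which [good_deletion] guarantees for the smaller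
    polyhedron. *)
Lemma generated_step_map N : smaller_generated N ->
  forall (D : finType) (e n : {perm D}) (G : polyhedron) (nu : D -> G),
  #|D| <= N -> polyhedral_map e n -> realizes e n nu ->
  (forall m, 3 <= m -> m <> 4 -> ~ giso (wheel m) G) ->
  generated op (wheel 4) G.
Proof.
move=> IH D e n G nu DN pm rG notW.
have IHD : smaller_generated #|D|.
  move=> D' e' n' G' nu' D'D; apply: IH; exact: leq_trans DN.
have [[x /(good_deletion pm rG)[y y3 yw]]|nodel] := deletable_or_not e nu.
  have [e' [n' [_ _ pm' rH]]] := deletion_polyhedral pm rG y3.
  pose H := Polyhedron (three_connected_of_polyhedral pm' rH) (polyhedral_planar pm' rH).
  apply: (@generated_step _ _ H); last first.
    apply/op_edge/(@del_edge_addition _ (nu y) (nu (e y))) => //.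
    exact: pm_nu_adj rG y.
  by apply: (IHD _ e' n' H _ (card_kept e y) pm' rH).
have pm' := polyhedral_map_dual pm.
have [H0 [mu rH]] := realizing_graph pm'.
pose H := Polyhedron (three_connected_of_polyhedral pm' rH) (polyhedral_planar pm' rH).
have [[x /(good_deletion pm' rH)[y y3 yw]]|nodel'] := deletable_or_not e mu.
  exact: (@op_dual D e n G H nu mu y).
have [m m3 mG] := irreducible_wheel pm rG rH nodel nodel'.
have [m4|/eqP m4] := eqVneq m 4; last by case: (notW m).
by apply: generated_start; rewrite -m4.
Qed.

Lemma all_smaller_generated N : smaller_generated N.
Proof.
elim: N => // N IH D e n G nu DN pm rG wG.
exact: (generated_step_map IH DN pm rG (not_wheel_like wG)).
Qed.

Lemma polyhedron_generated (G : polyhedron) :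
  (forall m, 3 <= m -> m <> 4 -> ~ giso (wheel m) G) ->
  generated op (wheel 4) G.
Proof.
have [s [cG rot euler]] := polyhedron_planar G => notW.
have rG : realizes (drev_perm G) s (@src G).
  split=> [x y|u|u v].
  - rewrite !rot; split=> [->//|/setP/(_ x)]; rewrite !inE eqxx.
    by move/esym/eqP.
  - have S0 : #|(set0 : {set G})| < 3 by rewrite cards0.
    have [v uv _] := three_connected_neighbour u (polyhedron_3connected G) S0.
    by exists (Sub (u, v) uv).
  split=> [uv|[x [<- <-]]]; last by rewrite permE; apply: (valP x).
  by exists (Sub (u, v) uv); rewrite permE.
have dK : involutive (drev_perm G) by move=> x; rewrite !permE drevK.
have pm : polyhedral_map (drev_perm G) s.
  apply: (polyhedral_of_three_connected dK rG (polyhedron_3connected G)).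
    move=> x y xy; rewrite !permE => exy; apply: val_inj.
    by rewrite [LHS]surjective_pairing [RHS]surjective_pairing; congr pair.
  by rewrite -euler -(card_realized rG).
exact: (generated_step_map (@all_smaller_generated _) (leqnn _) pm rG notW).
Qed.

End Generation.

Theorem theorem1p2 :
  (forall G : polyhedron,
     (forall n : nat, 3 <= n -> n <> 4 -> ~ giso (wheel n) G) ->
     generated (fun H K => edge_addition H K \/ vertex_expansion H K)
               (wheel 4) G) /\
  (forall G : polyhedron,
     (forall n : nat, 3 <= n -> n <> 4 -> ~ giso (wheel n) G) ->
     generated (fun H K => edge_addition H K \/ duality H K)
               (wheel 4) G).
Proof.
split; apply: polyhedron_generated; try by [left].
(* [K] is the contraction of [G] dual to the deletion in [H]. If [K] were [wheel_like], so would be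
   its dual, the reduced [H]. *)
- move=> D e n G H nu mu x IH pm rG rH x3 xw.
  have pm' := polyhedral_map_dual pm.
  have [e' [m' [e'E m'E pmH rH']]] := deletion_polyhedral pm' rH x3.
  have pmK := polyhedral_map_dual pmH.
  have [K [[nuK rK] expK]] := contraction_expansion pm rG e'E m'E pmH.
  apply: (@generated_step _ _ K); last by right; apply: expK; exists id => //; exists id.
  apply: (IH _ e' (e' * m')%g K nuK (card_kept e x)) => //.
  pose H' := del_edge (mu x) (mu (e x)).
  apply: contra xw; apply: (@wheel_like_dual _ _ _ _ H' _ (mu \o val) pmK rK).
  by rewrite involution_mulg //; apply: (pm_inv pmH).
(* [K] is the dual [H] with one edge deleted: adding the edge restores [H], and dualizing gives
   [G]. *)
move=> D e n G H nu mu x IH pm rG rH x3 xw.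
have pm' := polyhedral_map_dual pm.
have [e' [m' [_ _ pmH rH']]] := deletion_polyhedral pm' rH x3.
pose K := Polyhedron (three_connected_of_polyhedral pmH rH') (polyhedral_planar pmH rH').
have genK : generated (fun H K => edge_addition H K \/ duality H K) (wheel 4) K.
  exact: (IH _ e' m' K _ (card_kept e x) pmH rH').
apply: (@generated_step _ _ H).
  apply: generated_step genK _; left.
  by apply: (@del_edge_addition _ (mu x) (mu (e x))) => //; apply: (pm_nu_adj rH).
right; apply: (dual_realized pm' rH (mu := nu)).
by rewrite (involution_mulg _ (pm_inv pm)).
Qed.
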